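(* Let $0<\delta,\lambda<1$. For every stationary randomized MPE $\Pi$ and every fixed initial state, every accumulation point of the realized worldview path $(\alpha_t)$ belongs to $\mathcal Z_\Pi=\{\alpha\in\Delta^n:(1-\delta)S(\alpha)=h(\alpha)\}$ almost surely. At each $p\in\mathcal Z_\Pi$ and for every $x\in z^*(p)$, $U(p,x)=h(p)=M(x)$, and $p^i>0$ implies $u_i(x)=M(x)$. If $|\arg\max_{j\in J}u_j(x)|=1$ for every $x\in X^I$, then there is a random index $J_\infty\in J$ such that $\alpha_t\to\alpha(J_\infty)$ almost surely. For fixed finite $J,X$, the payoff arrays $u\in\mathbb R^{|J||X|}$ admitting a stationary randomized MPE that fails to converge to a pure worldview with positive probability from some fixed initial state are contained in $\bigcup_{x\in X}\bigcup_{i<j}\{u:u_i(x)=u_j(x)\}$; in particular, that set has empty interior. If, in addition to $|\arg\max_{j\in J}u_j(x)|=1$ for every $x\in X^I$, one has $z^*(\alpha(j))=\{x_j\}$ for every $j\in J$ and $\widehat\lambda<\lambda<1$ (with $\widehat\lambda$ as in the context), then an absorbing pure worldview is reached in finite time almost surely.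
   Context: $J=\{1,\ldots,n\}$ and $X$ are nonempty finite sets (pure worldviews and actions) with payoffs $u_j(x)\in\mathbb R$; $M(x)=\max_{j\in J}u_j(x)$. $\Delta^n=\{\alpha\in\mathbb R^n:\alpha^j\ge0,\ \sum_j\alpha^j=1\}$; $\alpha(j)$ is the vertex with weight one on $j$ (pure worldview). $U(\alpha,x)=\sum_j\alpha^ju_j(x)$, $z^*(\alpha)=\arg\max_{x\in X}U(\alpha,x)$, $h(\alpha)=\max_{x\in X}U(\alpha,x)$, $X^I=\bigcup_{\alpha\in\Delta^n}z^*(\alpha)$. A stationary randomized strategy is a Borel probability kernel $\alpha\mapsto\Pi_\alpha$ from $\Delta^n$ to $X\times\Delta^n$, with marginals $s_\alpha$ on $X$ and $\kappa_\alpha$ on $\Delta^n$. From a fixed $\alpha_0$, conditional on the history $(\alpha_0,x_0,\ldots,x_{t-1},\alpha_t)$, the pair $(x_t,\alpha_{t+1})$ has law $\Pi_{\alpha_t}$; $\mathbb E_\beta$ is expectation when $\alpha_0=\beta$. Put $$C_\Pi(\beta;\alpha)=\mathbb E_\beta\sum_{k=0}^\infty\delta^k\big[(1-\lambda)U(\alpha_k,x_k)+\lambda U(\alpha,x_k)\big],\qquad S(\alpha)=\int C_\Pi(\beta;\alpha)\,\kappa_\alpha(d\beta).$$ $\Pi$ is a stationary randomized MPE if for every $\alpha\in\Delta^n$: $s_\alpha(z^*(\alpha))=1$ and $S(\alpha)\ge C_\Pi(\gamma;\alpha)$ for every $\gamma\in\Delta^n$. A state $\alpha$ is absorbing if $\kappa_\alpha(\{\alpha\})=1$.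 Threshold (when $z^*(\alpha(j))=\{x_j\}$ for all $j$): $h_j=u_j(x_j)$, $J^\dagger=\{j\in J:u_j(x_j)=M(x_j)\}$; for $j\in J^\dagger$, $y\in X\setminus\{x_j\}$, $D_{jy}=h_j-u_j(y)>0$, $R_{jy}=M(y)-u_j(y)\ge0$, and $$\widehat\lambda=\max\Big(\{0\}\cup\Big\{1-\frac{D_{jy}}{R_{jy}}:j\in J^\dagger,\ y\in X\setminus\{x_j\},\ R_{jy}>0\Big\}\Big)<1.$$ *)

(* Defs.v *)
From HB Require Import structures.
From mathcomp Require Import all_boot all_order all_algebra.
From mathcomp Require Import all_classical all_reals all_analysis.

Set Implicit Arguments.
Unset Strict Implicit.
Unset Printing Implicit Defensive.

Import Order.TTheory GRing.Theory Num.Theory.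
Import numFieldNormedType.Exports.

Local Open Scope classical_set_scope.
Local Open Scope ring_scope.

(* [X : finPointedType] is a nonempty finite set. *)
#[short(type="finPointedType")]
HB.structure Definition FinPointed := {T of Finite T & isPointed T}.

(* [X] with the sigma-algebra of all its subsets. *)
Definition discr (X : finPointedType) : Type := X.

HB.instance Definition _ (X : finPointedType) := FinPointed.on (discr X).
HB.instance Definition _ (X : finPointedType) :=
  @isMeasurable.Build default_measure_display (discr X) discrete_measurable
    discrete_measurable0 discrete_measurableC discrete_measurableU.

(* Throughout, the set J of pure worldviews is ['I_n.+1]. *)

Definition simplex (R : realType) (n : nat) : set 'rV[R]_n.+1 :=
  [set a | (forall j, 0 <= a 0 j) /\ \sum_j a 0 j = 1].

Arguments simplex : clear implicits.

Definition worldview (R : realType) (n : nat) : Type := set_type (simplex R n).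

Definition weight (R : realType) (n : nat) (a : worldview R n) (j : 'I_n.+1) : R :=
  \val a 0 j.

Lemma vertex_subproof (R : realType) (n : nat) (j : 'I_n.+1) :
  (delta_mx 0 j : 'rV[R]_n.+1) \in simplex R n.
Proof.
apply/mem_set; split=> [i|]; first by rewrite mxE ler0n.
rewrite (bigD1 j) //= big1 => [|i ij]; first by rewrite mxE !eqxx addr0.
by rewrite mxE (negbTE ij) andbF.
Qed.

Definition vertex (R : realType) (n : nat) (j : 'I_n.+1) : worldview R n :=
  exist _ (delta_mx 0 j) (vertex_subproof R j).

Arguments vertex R {n} j.

(* Euclidean (subspace) topology and Borel sigma-algebra of the simplex. *)
HB.instance Definition _ (R : realType) (n : nat) :=
  Topological.copy (worldview R n) (set_type (simplex R n)).
HB.instance Definition _ (R : realType) (n : nat) :=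
  isPointed.Build (worldview R n) (vertex R ord0).
HB.instance Definition _ (R : realType) (n : nat) :=
  @isMeasurable.Build (sigma_display (@open (worldview R n))) (worldview R n)
    <<s @open (worldview R n) >>
    (@sigma_algebra0 _ setT _) (@sigma_algebraC _ _)
    (@sigma_algebra_bigcup _ setT _).

Section Payoffs.
Context (R : realType) (n : nat) (X : finPointedType).
Variable u : 'I_n.+1 -> X -> R.

Definition Mx (x : X) : R := \big[Num.max/u ord0 x]_(j < n.+1) u j x.

Definition U (a : worldview R n) (x : X) : R := \sum_(j < n.+1) weight a j * u j x.

Definition zstar (a : worldview R n) : set X :=
  [set x | forall y, U a y <= U a x].

Definition h (a : worldview R n) : R := \big[Num.max/U a point]_(x : X) U a x.

Definition XI : set X := \bigcup_(a in [set: worldview R n]) zstar a.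

Definition unique_argmax (x : X) : Prop :=
  #|[pred j : 'I_n.+1 | [forall i, u i x <= u j x]]| = 1%N.

Section Threshold.
Variable xs : 'I_n.+1 -> X.

Definition Jdagger : pred 'I_n.+1 := [pred j | u j (xs j) == Mx (xs j)].

Definition Dgap (j : 'I_n.+1) (y : X) : R := u j (xs j) - u j y.

Definition Rgap (j : 'I_n.+1) (y : X) : R := Mx y - u j y.

Definition lambda_hat : R :=
  \big[Num.max/0]_(j | Jdagger j)
    \big[Num.max/0]_(y | (y != xs j) && (0 < Rgap j y)) (1 - Dgap j y / Rgap j y).

End Threshold.
End Payoffs.

Notation strategy R n X :=
  (R.-pker (worldview R n) ~> (discr X * worldview R n)%type).

Section Strategies.
Context (R : realType) (n : nat) (X : finPointedType).
Variable Pi : strategy R n X.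

Definition s_marg (a : worldview R n) : set (discr X) -> \bar R :=
  pushforward (Pi a) fst.

Definition kappa (a : worldview R n) : set (worldview R n) -> \bar R :=
  pushforward (Pi a) snd.

Definition absorbing (a : worldview R n) : Prop := kappa a [set a] = 1%E.

(* The sigma-algebra of the history (alpha_0, x_0, ..., x_(t-1), alpha_t). *)
Definition history d (Omega : measurableType d)
    (view : nat -> Omega -> worldview R n) (act : nat -> Omega -> discr X)
    (t : nat) : set (set Omega) :=
  <<s (\bigcup_(k in [set k | (k <= t)%N])
         preimage_set_system setT (view k) measurable)
      `|` (\bigcup_(k in [set k | (k < t)%N])
         preimage_set_system setT (act k) measurable) >>.

(* A family (P_beta) of probabilities and a process (alpha_t, x_t) which under
   P_beta starts at beta and has the transition law Pi. By Ionescu-Tulcea every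
   Pi has a realization, and the law of the process under P_beta is unique, so
   nothing below depends on the choice of a realization.
   [realize_trans]: the conditional law of (x_t, alpha_(t+1)) given the history
   up to alpha_t is Pi_(alpha_t). *)
Record realization := Realization {
  rdisp : measure_display;
  Omega : measurableType rdisp;
  Pr : worldview R n -> probability Omega R;
  view : nat -> {mfun Omega >-> worldview R n};
  act : nat -> {mfun Omega >-> discr X};
  realize_init : forall b, Pr b (view 0%N @^-1` [set b]) = 1%E;
  realize_trans : forall (b : worldview R n) (t : nat) (H : set Omega)
      (B : set (discr X * worldview R n)),
    history view act t H -> measurable B ->
    Pr b (H `&` [set w | B (act t w, view t.+1 w)]) =
    (\int[Pr b]_(w in H) Pi (view t w) B)%E }.

End Strategies.

Section Equilibrium.
Context (R : realType) (n : nat) (X : finPointedType).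
Variables (delta lambda : R) (u : 'I_n.+1 -> X -> R).
Variables (Pi : strategy R n X) (M : realization Pi).

Definition stage_payoff (a b : worldview R n) (x : X) : R :=
  (1 - lambda) * U u b x + lambda * U u a x.

(* [Cpay b a] is C_Pi(b; a). *)
Definition Cpay (b a : worldview R n) : \bar R :=
  ('E_(Pr M b)[fun w => limn (series (fun k : nat =>
     delta ^+ k * stage_payoff a (view M k w) (act M k w)))%R])%E.

Definition Spay (a : worldview R n) : \bar R := (\int[kappa Pi a]_b Cpay b a)%E.

Definition is_MPE : Prop :=
  forall a, s_marg Pi a (zstar u a) = 1%E /\ forall c, (Cpay c a <= Spay a)%E.

Definition Zset : set (worldview R n) :=
  [set a | ((1 - delta)%:E * Spay a = (h u a)%:E)%E].

End Equilibrium.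

Definition converges_to (R : realType) (n : nat) (X : finPointedType)
    (Pi : strategy R n X) (M : realization Pi) (w : Omega M) (j : 'I_n.+1) : Prop :=
  (fun t => view M t w) @ \oo --> vertex R j.

Definition bad_payoffs (R : realType) (n : nat) (X : finPointedType)
    (delta lambda : R) : set ('I_n.+1 -> X -> R) :=
  [set u | exists (Pi : strategy R n X) (M : realization Pi),
     is_MPE delta lambda u M /\
     exists b, (0 < Pr M b [set w | ~ exists j, converges_to w j])%E].

Arguments bad_payoffs R n X delta lambda : clear implicits.

(* Main.v *)
Require Import Defs.
From HB Require Import structures.
From mathcomp Require Import all_boot all_order all_algebra.
From mathcomp Require Import all_classical all_reals all_analysis.
From mathcomp Require Import measurable_realfun lra ring.
Set Implicit Arguments.
Unset Strict Implicit.
Unset Printing Implicit Defensive.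
Import Order.TTheory GRing.Theory Num.Theory.
Import numFieldNormedType.Exports.
Local Open Scope classical_set_scope.
Local Open Scope ring_scope.

(** Write C(c; a) for the payoff of starting at c judged by a. It is affine in a,
    and in equilibrium S(a) = max_c C(c; a), attained for kappa_a-almost every c.
    Splitting off the first period of C(a_(t+1); a_t) = S(a_t) gives
    (1 - delta) S(a_t) <= (1 - lambda) h(a_(t+1)) + lambda U(a_t, x_(t+1)); together
    with h <= (1 - delta) S this makes S(a_t) nondecreasing and bounds the gap
    (1 - delta) S - h at a_t by a multiple of S(a_(t+1)) - S(a_t). Hence the gap
    tends to 0 along the path, and, S being Lipschitz, it vanishes at every
    accumulation point. When argmaxes are unique the zeros of the gap are vertices,
    and the same one-period inequality, passed to the limit along pairs
    (a_t, a_(t+1)), forbids jumping from one vertex to another infinitely often.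
    Above the threshold, every c other than a limit vertex is strictly worse than
    the vertex for itself, so the vertex is absorbing, and a state close to it can
    only move exactly onto it. *)

(** * Discounted sums and bounded measurable functions *)

(** No continuity is assumed of the kernel, so limits are taken only in S, h and the payoffs U of
    single actions. The continuation payoff from a state b judged by a is affine in a, with
    coefficients bounded uniformly in b; S(a) dominates all of these and is attained at b = a,
    whence the Lipschitz bound. The action drawn at the next state is controlled by the upper
    hemicontinuity of [zstar] on a finite set of actions. To have this affine form at hand, C(c; a)
    is rebuilt from functions of c alone, with the weights of a as coefficients, which also makes it
    measurable in both variables jointly. The rebuilt value equals the expected payoff because
    realized actions are optimal for the worldview that plays them, so that U(a_k, x_k) = h(a_k).
    Probability is then used once, to obtain C(a_(t+1); a_t) = S(a_t) at all dates almost surely;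
    the dynamics are studied on one deterministic sequence with this property. *)

Section Discount.
Context {R : realType} (delta : R) (delta01 : 0 < delta < 1).
Implicit Types c : nat -> R.

Definition discount (d : R) c : R := limn (series (fun k => d ^+ k * c k)).

Lemma discount_cvg c K : (forall k, `|c k| <= K) ->
  cvgn (series (fun k => delta ^+ k * c k)).
Proof.
move=> cK; have /andP[d0 d1] := delta01.
apply: (@normed_cvg _ R^o).
apply: (@series_le_cvg _ _ (geometric K delta)) => [k|k|k|] /=.
- by [].
- by rewrite mulr_ge0 ?exprn_ge0 ?(ltW d0)// (le_trans _ (cK 0%N)).
- by rewrite normrM normrX (gtr0_norm d0) mulrC ler_wpM2r// exprn_ge0// ltW.
- by apply: is_cvg_geometric_series; rewrite gtr0_norm.
Qed.

(** The bound on partial sums is uniform in their length, so the constant [K / (1 - delta)] can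
    dominate them when integral and discounted sum are exchanged. *)
Lemma discount_le c K : (forall k, `|c k| <= K) ->
  (forall n, `|series (fun k => delta ^+ k * c k) n| <= K / (1 - delta)) /\
  `|discount delta c| <= K / (1 - delta).
Proof.
move=> cK; have /andP[d0 d1] := delta01.
have K0 : 0 <= K by rewrite (le_trans _ (cK 0%N)).
have sle n : `|series (fun k => delta ^+ k * c k) n| <= K / (1 - delta).
  rewrite /series/=; apply: (le_trans (ler_norm_sum _ _ _)).
  apply: (@le_trans _ _ (series (geometric K delta) n)).
    rewrite /series/=; apply: ler_sum => k _.
    by rewrite normrM normrX (gtr0_norm d0) mulrC ler_wpM2r// exprn_ge0// ltW.
  rewrite geometric_seriesE ?lt_eqF//= -mulrA ler_wpM2l// ler_pdivrMr ?subr_gt0//.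
  by rewrite mulVf ?gt_eqF ?subr_gt0// lerBlDr lerDl exprn_ge0// ltW.
split=> //; have cv := discount_cvg cK.
rewrite -lim_norm//; apply: limr_le; first exact: is_cvg_norm.
by near=> k; exact: sle.
Unshelve. all: by end_near. Qed.

Lemma discount_rec c K : (forall k, `|c k| <= K) ->
  discount delta c = c 0%N + delta * discount delta (fun k => c k.+1).
Proof.
move=> cK; apply/cvg_lim => //; rewrite -cvg_shiftS /=.
rewrite (_ : (fun n => _) = fun n => c 0%N + delta *
    series (fun k => delta ^+ k * c k.+1) n); last first.
  apply/funext => n; rewrite /series/= big_nat_recl// expr0 mul1r; congr (_ + _).
  by rewrite mulr_sumr; apply: eq_bigr => k _; rewrite exprS mulrA.
apply: cvgD; first exact: cvg_cst.
apply: cvgM; first exact: cvg_cst.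
exact: (@discount_cvg _ K).
Qed.

Lemma discountD c c' K K' : (forall k, `|c k| <= K) -> (forall k, `|c' k| <= K') ->
  discount delta (fun k => c k + c' k) = discount delta c + discount delta c'.
Proof.
move=> cK cK'; rewrite /discount -lim_seriesD; first last.
- exact: discount_cvg cK'.
- exact: discount_cvg cK.
by congr (limn (series _)); apply/funext => k; rewrite fctE mulrDr.
Qed.

Lemma discountZ c K r : (forall k, `|c k| <= K) ->
  discount delta (fun k => r * c k) = r * discount delta c.
Proof.
move=> cK; rewrite /discount.
rewrite -[r * _]/(r *: (_ : R^o)) -lim_seriesZ; last exact: discount_cvg cK.
by congr (limn (series _)); apply/funext => k; rewrite fctE /= mulrCA.
Qed.

End Discount.

(** This class is closed under all the operations below and integrable against every measure of mass
    one, so values can be handled as real numbers with no case for infinite integrals. *)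
Definition bounded_measurable {d} {T : measurableType d} {R : realType}
    (f : T -> R) : Prop :=
  measurable_fun setT f /\ exists K, forall x, `|f x| <= K.

Section BoundedMeasurable.
Context {d} {T : measurableType d} {R : realType}.
Implicit Types (mu : {measure set T -> \bar R}) (f g : T -> R) (r : R).

(** Mass one is a hypothesis on a plain measure because a kernel value such as [Pi b] is typed as a
    measure, not as a probability. *)
Lemma bounded_measurable_integrable mu (mu1 : mu setT = 1%E) f : bounded_measurable f ->
  mu.-integrable setT (EFin \o f).
Proof.
move=> [mf [K fK]]; apply: measurable_bounded_integrable => //.
- by rewrite mu1 ltry.
- by exists K; split=> [|x Kx y _]; [exact: num_real|exact: le_trans (fK y) (ltW Kx)].
Qed.

Lemma bounded_measurable_cst r : bounded_measurable (fun _ : T => r).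
Proof. by split; [exact: measurable_cst|exists `|r|]. Qed.

Lemma bounded_measurableD f g : bounded_measurable f -> bounded_measurable g ->
  bounded_measurable (fun x => f x + g x).
Proof.
move=> [mf [K fK]] [mg [L gL]]; split; first exact: measurable_funD.
by exists (K + L) => x; rewrite (le_trans (ler_normD _ _))// lerD.
Qed.

Lemma bounded_measurableM f g : bounded_measurable f -> bounded_measurable g ->
  bounded_measurable (fun x => f x * g x).
Proof.
move=> [mf [K fK]] [mg [L gL]]; split; first exact: measurable_funM.
by exists (K * L) => x; rewrite normrM ler_pM.
Qed.

Lemma bounded_measurableZ r f : bounded_measurable f ->
  bounded_measurable (fun x => r * f x).
Proof. by move=> bf; apply: bounded_measurableM => //; exact: bounded_measurable_cst. Qed.

Lemma bounded_measurable_sum (I : Type) (s : seq I) (F : I -> T -> R) :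
  (forall i, bounded_measurable (F i)) ->
  bounded_measurable (fun x => \sum_(i <- s) F i x).
Proof.
move=> bF; elim: s => [|i s ih].
  under eq_fun do rewrite big_nil; exact: bounded_measurable_cst.
under eq_fun do rewrite big_cons; exact: bounded_measurableD.
Qed.

Lemma bounded_measurable_comp {d'} {T' : measurableType d'} (g : T' -> T) f :
  measurable_fun setT g -> bounded_measurable f -> bounded_measurable (f \o g).
Proof.
move=> mg [mf [K fK]]; split; first exact: measurableT_comp.
by exists K => x; exact: fK.
Qed.

Lemma Rintegral_sum mu (mu1 : mu setT = 1%E) (I : Type) (s : seq I) (F : I -> T -> R) :
  (forall i, bounded_measurable (F i)) ->
  \int[mu]_x (\sum_(i <- s) F i x) = \sum_(i <- s) \int[mu]_x F i x.
Proof.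
move=> bF; elim: s => [|i s ih].
  rewrite big_nil; under eq_Rintegral do rewrite big_nil.
  by rewrite Rintegral_cst// mul0r.
rewrite big_cons -ih -RintegralD//; last 2 first.
- exact: bounded_measurable_integrable.
- by apply: bounded_measurable_integrable => //; exact: bounded_measurable_sum.
by apply: eq_Rintegral => x _; rewrite big_cons.
Qed.

Lemma Rintegral_probability_cst mu (mu1 : mu setT = 1%E) r : \int[mu]_x r = r.
Proof.
rewrite Rintegral_cst// (_ : fine _ = 1) ?mulr1//.
by rewrite mu1.
Qed.

Lemma Rintegral_le_cst mu (mu1 : mu setT = 1%E) f K : bounded_measurable f -> (forall x, f x <= K) ->
  \int[mu]_x f x <= K.
Proof.
move=> bf fK; rewrite -[leRHS](Rintegral_probability_cst mu1).
apply: le_Rintegral => //; first exact: bounded_measurable_integrable.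
exact: (bounded_measurable_integrable mu1 (bounded_measurable_cst _)).
Qed.

Lemma le_normr_Rintegral_cst mu (mu1 : mu setT = 1%E) f K : bounded_measurable f ->
  (forall x, `|f x| <= K) -> `|\int[mu]_x f x| <= K.
Proof.
move=> bf fK; apply: (le_trans (le_normr_Rintegral _ _)) => //.
  exact: bounded_measurable_integrable.
apply: Rintegral_le_cst => //; split; first by apply: measurableT_comp => //; case: bf.
by exists K => x; rewrite normr_id.
Qed.

Lemma EFin_Rintegral mu (mu1 : mu setT = 1%E) f : bounded_measurable f ->
  (\int[mu]_x f x)%:E = (\int[mu]_x (f x)%:E)%E.
Proof.
move=> bf; rewrite /Rintegral fineK//; apply: integrable_fin_num => //.
exact: bounded_measurable_integrable.
Qed.

Lemma bounded_measurable_discount (delta : R) (c : nat -> T -> R) K : 0 < delta < 1 ->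
  (forall k, measurable_fun setT (c k)) -> (forall k x, `|c k x| <= K) ->
  bounded_measurable (fun x => discount delta (c ^~ x)).
Proof.
move=> d01 mc cK; split; last first.
  by exists (K / (1 - delta)) => x; apply: (discount_le d01 _).2 => k; exact: cK.
apply: (@measurable_fun_cvg _ _ _ _ (fun n x => series (fun k => delta ^+ k * c k x) n)).
  move=> n; suff [] : bounded_measurable (fun x => \sum_(0 <= k < n) delta ^+ k * c k x) by [].
  apply: bounded_measurable_sum => k; apply: bounded_measurableZ.
  by split; [exact: mc|exists K].
by move=> x _; apply: (@discount_cvg _ _ d01 _ K) => k; exact: cK.
Qed.

Lemma Rintegral_discount mu (mu1 : mu setT = 1%E) (delta : R) (c : nat -> T -> R) K :
  0 < delta < 1 ->
  (forall k, measurable_fun setT (c k)) -> (forall k x, `|c k x| <= K) ->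
  \int[mu]_x discount delta (c ^~ x) = discount delta (fun k => \int[mu]_x c k x).
Proof.
move=> d01 mc cK; have bc k : bounded_measurable (c k) by split; [exact: mc|exists K].
pose S_ n x := series (fun k => delta ^+ k * c k x) n.
have bS n : bounded_measurable (S_ n).
  by apply: bounded_measurable_sum => k; exact: bounded_measurableZ.
have blim := bounded_measurable_discount d01 mc cK.
have [||||| _ _ cvS] := @dominated_convergence _ T R mu setT measurableT
  (fun n x => (S_ n x)%:E) (fun x => (discount delta (c ^~ x))%:E)
  (fun=> (K / (1 - delta))%:E).
- by move=> n; apply/measurable_EFinP; case: (bS n).
- by apply/measurable_EFinP; case: blim.
- apply: aeW => x _; apply: cvg_EFin; first exact: nearW.
  by apply: (@discount_cvg _ _ d01 _ K) => k; exact: cK.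
- exact: (bounded_measurable_integrable mu1 (bounded_measurable_cst (K / (1 - delta)))).
- apply: aeW => x n _; rewrite abse_EFin lee_fin.
  by apply: (discount_le d01 _).1 => k; exact: cK.
apply/esym/cvg_lim => //.
move: cvS; rewrite -EFin_Rintegral// => /fine_cvg; apply: cvg_trans.
apply: near_eq_cvg; apply: nearW => n /=.
rewrite -[LHS]/(\int[mu]_x (\sum_(0 <= k < n) delta ^+ k * c k x)).
rewrite (Rintegral_sum mu1); last by move=> k; exact: bounded_measurableZ.
apply: eq_bigr => k _; rewrite RintegralZl//.
exact: (bounded_measurable_integrable mu1).
Qed.

Lemma eq_ae_Rintegral mu f g : measurable_fun setT f -> measurable_fun setT g ->
  {ae mu, forall x, f x = g x} -> \int[mu]_x f x = \int[mu]_x g x.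
Proof.
move=> mf mg fg; congr fine; apply: ae_eq_integral => //; try exact/measurable_EFinP.
by case: fg => N [mN N0 sN]; exists N; split => // x /= h; apply: sN => /= e; apply: h; rewrite e.
Qed.

Lemma measure1_ae mu (mu1 : mu setT = 1%E) (D : set T) : measurable D ->
  mu D = 1%E <-> {ae mu, forall x, D x}.
Proof.
move=> mD; have muDC : (mu (~` D) + mu D = 1)%E.
  by rewrite -measureU//; [rewrite setUC setUv|exact: measurableC|rewrite setICl].
split=> [D1|[N [mN N0 sN]]].
  exists (~` D); split => //; first exact: measurableC.
  by rewrite D1 in muDC; rewrite -[LHS](@addeK _ 1%E)// muDC subee.
have : mu (~` D) = 0%E.
  by apply: (subset_measure0 _ mN sN N0); exact: measurableC.
by move=> D0; rewrite D0 add0e in muDC.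
Qed.

(** [K - f] is nonnegative with zero integral. Used with C(c; a) for [f] and S(a), both its average
    and its upper bound, for [K]: almost every continuation is then optimal. *)
Lemma Rintegral_eq_upper_bound mu (mu1 : mu setT = 1%E) f K : bounded_measurable f ->
  (forall x, f x <= K) -> \int[mu]_x f x = K -> {ae mu, forall x, f x = K}.
Proof.
move=> bf fK fe.
have bg : bounded_measurable (fun x => K - f x).
  by apply: bounded_measurableD; [exact: bounded_measurable_cst|
    under eq_fun do rewrite -mulN1r; exact: bounded_measurableZ].
have g0 : \int[mu]_x (K - f x) = 0.
  rewrite RintegralB//; last 2 first.
  - exact: (bounded_measurable_integrable mu1 (bounded_measurable_cst K)).
  - exact: (bounded_measurable_integrable mu1 bf).
  by rewrite (Rintegral_probability_cst mu1) fe subrr.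
have mg : measurable_fun setT (fun x => (K - f x)%:E).
  by apply/measurable_EFinP; case: bg.
have : (\int[mu]_x `|(K - f x)%:E| = 0)%E.
  under eq_integral => x _ do rewrite abse_EFin ger0_norm ?subr_ge0//.
  by rewrite -(EFin_Rintegral mu1)// g0.
move/(ae_eq_integral_abs mu measurableT mg) => [N [mN N0 sN]].
exists N; split => // x /= h; apply: sN => /= e; apply: h.
by have [/subr0_eq] := e I.
Qed.

End BoundedMeasurable.

(** * Disintegration of a joint law along a kernel *)

Section Disintegration.
Context {d1 d2 d3} {Omega : measurableType d1} {T : measurableType d2}
  {Z : measurableType d3} {R : realType}.
Variables (P : probability Omega R) (v : Omega -> T) (z : Omega -> Z).
Variable k : R.-pker T ~> Z.
Hypotheses (mv : measurable_fun setT v) (mz : measurable_fun setT z).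
Hypothesis Pvz : forall A B, measurable A -> measurable B ->
  (P (v @^-1` A `&` z @^-1` B) = \int[P]_(w in v @^-1` A) k (v w) B)%E.

(** [P] is viewed as a kernel from the one-point space and [k] along [v] as a kernel [kv] above it,
    so that the iterated integral is a single integral against a composed kernel. *)
Let mP : measurable_fun setT (fun _ : unit => (P : pprobability Omega R)) :=
  measurable_cst (P : pprobability Omega R).

Let kv (x : unit * Omega) : {measure set Z -> \bar R} := k (v x.2).

Let measurable_kv U : measurable U -> measurable_fun setT (kv ^~ U).
Proof.
move=> mU; apply: (measurableT_comp (measurable_kernel k U mU)).
exact: measurableT_comp mv measurable_snd.
Qed.

HB.instance Definition _ := isKernel.Build _ _ _ _ _ kv measurable_kv.

Let kv_prob x : kv x setT = 1%E. Proof. exact: prob_kernel. Qed.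

HB.instance Definition _ := Kernel_isProbability.Build _ _ _ _ _ kv kv_prob.

Lemma ge0_integral_disintegration (g : Z -> \bar R) : (forall x, 0 <= g x)%E ->
  measurable_fun setT g ->
  (\int[P]_w g (z w) = \int[P]_w \int[k (v w)]_x g x)%E.
Proof.
move=> g0 mg.
rewrite -[RHS](integral_kcomp (kprobability mP) kv tt)//.
transitivity (\int[pushforward P z]_y g y)%E.
  by rewrite ge0_integral_pushforward.
apply: eq_measure_integral => A mA _.
transitivity (P (v @^-1` setT `&` z @^-1` A)).
  by rewrite preimage_setT setTI.
by rewrite Pvz.
Qed.


Lemma kernel_Rintegral (g : Z -> R) : bounded_measurable g ->
  bounded_measurable (fun b => \int[k b]_x g x).
Proof.
move=> bg; have [mg [K gK]] := bg.
(* Measurability of kernel integrals is applied to a nonnegative integrand, so the bound [K] is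
   added first and subtracted after integration. *)
pose g' x := g x + K.
have g'0 x : 0 <= g' x.
  by rewrite -lerBlDr sub0r; move: (gK x); rewrite ler_norml => /andP[].
have bg' : bounded_measurable g'.
  by apply: bounded_measurableD => //; exact: bounded_measurable_cst.
have kg b : \int[k b]_x g x = fine (\int[k b]_x (g' x)%:E)%E - K.
  rewrite -[fine _]/(\int[k b]_x g' x) RintegralD//; last 2 first.
  - exact: (bounded_measurable_integrable (prob_kernel b)).
  - exact: (bounded_measurable_integrable (prob_kernel b) (bounded_measurable_cst K)).
  by rewrite (Rintegral_probability_cst (prob_kernel b)) addrK.
split; last by exists K => b; exact: (le_normr_Rintegral_cst (prob_kernel b)).
under eq_fun do rewrite kg.
apply: measurable_funB => //; apply: measurableT_comp => //.
apply: measurable_fun_integral_kernel.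
- by move=> U mU; exact: measurable_kernel.
- by move=> x; rewrite lee_fin.
- by apply/measurable_EFinP; case: bg'.
Qed.

Lemma Rintegral_disintegration (g : Z -> R) : bounded_measurable g ->
  \int[P]_w g (z w) = \int[P]_w \int[k (v w)]_x g x.
Proof.
move=> bg; have [mg [K gK]] := bg.
pose g' x := g x + K.
have g'0 x : 0 <= g' x.
  by rewrite -lerBlDr sub0r; move: (gK x); rewrite ler_norml => /andP[].
have bK d (T0 : measurableType d) := @bounded_measurable_cst _ T0 R K.
have bg' : bounded_measurable g' by exact: bounded_measurableD.
have P1 : P setT = 1%E by exact: probability_setT.
have bkg : bounded_measurable (fun w => \int[k (v w)]_x g x).
  exact: (bounded_measurable_comp mv (kernel_Rintegral bg)).
have bgz : bounded_measurable (fun w => g (z w)) by exact: (bounded_measurable_comp mz).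
have e1 : \int[P]_w g' (z w) = \int[P]_w g (z w) + K.
  rewrite RintegralD//; last 2 first.
  - exact: (bounded_measurable_integrable P1).
  - exact: (bounded_measurable_integrable P1 (bounded_measurable_cst K)).
  by rewrite (Rintegral_probability_cst P1).
have e2 b : \int[k b]_x g' x = \int[k b]_x g x + K.
  rewrite RintegralD//; last 2 first.
  - exact: (bounded_measurable_integrable (prob_kernel b)).
  - exact: (bounded_measurable_integrable (prob_kernel b) (bounded_measurable_cst K)).
  by rewrite (Rintegral_probability_cst (prob_kernel b)).
have e3 : \int[P]_w \int[k (v w)]_x g' x = \int[P]_w \int[k (v w)]_x g x + K.
  under eq_Rintegral do rewrite e2.
  rewrite RintegralD//; last 2 first.
  - exact: (bounded_measurable_integrable P1).
  - exact: (bounded_measurable_integrable P1 (bounded_measurable_cst K)).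
  by rewrite (Rintegral_probability_cst P1).
apply: (addIr K); rewrite -e1 -e3 {1}/Rintegral.
rewrite (@ge0_integral_disintegration (fun x => (g' x)%:E)); last 2 first.
- by move=> x; rewrite lee_fin.
- by apply/measurable_EFinP; case: bg'.
congr fine; apply: eq_integral => w _.
by rewrite (EFin_Rintegral (prob_kernel _)).
Qed.

(** The hypothesis [Pvz] covers rectangles only. These are stable under intersection, and a Dynkin
    class argument extends the identity to events that relate [v] and [z]. *)
Lemma probability_disintegration (D : set (T * Z)) : measurable D ->
  (P [set w | D (v w, z w)] = \int[P]_w k (v w) (xsection D (v w)))%E.
Proof.
have mvz : measurable_fun setT (fun w => (v w, z w)) by exact: measurable_fun_pair.
have mvzD D' : measurable D' -> measurable [set w | D' (v w, z w)].
  by move=> mD'; rewrite -[X in measurable X]setTI; exact: mvz.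
have mk D' : measurable D' -> measurable_fun setT (fun w => k (v w) (xsection D' (v w))).
  move=> mD'; apply: (measurableT_comp (f := fun b => k b (xsection D' b))) => //.
  by apply: (@measurable_fun_xsection_finite_kernel _ _ _ _ _ k); rewrite inE.
pose G := [set A `*` B | A in @measurable _ T & B in @measurable _ Z].
pose Q D' := (P [set w | D' (v w, z w)] = \int[P]_w k (v w) (xsection D' (v w)))%E.
move=> mD; rewrite -/(Q D); move: D mD.
suff : forall D, <<s G >> D -> Q D.
  by move=> h D mD; apply: h; rewrite -measurable_prod_measurableType.
apply: dynkin_induction; first exact: measurable_prod_measurableType.
- move=> _ _ [X1 mX1 [X2 mX2 <-]] [Y1 mY1 [Y2 mY2 <-]].
  exists (X1 `&` Y1); first exact: measurableI.
  by exists (X2 `&` Y2); [exact: measurableI|rewrite setXI].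
- rewrite /Q; under eq_integral => w _.
    rewrite (_ : xsection _ _ = setT); last by rewrite xsectionE.
    rewrite prob_kernel; over.
  by rewrite integral_cst// mul1e.
- move=> _ [A mA [B mB <-]]; rewrite /Q.
  rewrite (_ : [set w | _] = v @^-1` A `&` z @^-1` B)// Pvz// integral_mkcond.
  apply: eq_integral => w _; rewrite patchE.
  have [wA|wA] := boolP (v w \in A).
    by rewrite ifT ?in_xsectionX// inE; exact: set_mem.
  rewrite ifF ?notin_xsectionX ?measure0//.
  by apply/negbTE; apply: contra wA; rewrite !inE.
- move=> S mS QS; rewrite /Q.
  rewrite (_ : [set w | _] = ~` [set w | S (v w, z w)])//.
  rewrite probability_setC; last exact: mvzD.
  have e : (\int[P]_w k (v w) (xsection (~` S) (v w)) +
      P [set w | S (v w, z w)] = 1)%E.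
    rewrite (QS : P _ = _) -ge0_integralD//; last 2 first.
    - exact/mk/measurableC.
    - exact: mk.
    rewrite -(probability_setT P) -[RHS]mul1e -integral_cst//.
    apply: eq_integral => w _.
    rewrite -(prob_kernel (s := k) (v w)) -measureU//.
    - by congr (k (v w) _); rewrite !xsectionE preimage_setC setUC setUv.
    - by apply: measurable_xsection; exact: measurableC.
    - exact: measurable_xsection.
    - by rewrite !xsectionE preimage_setC setICl.
  by rewrite -[in LHS]e addeK// fin_num_measure//; exact: mvzD.
- move=> F mF tF QF; rewrite /Q.
  rewrite (_ : [set w | _] = \bigcup_i [set w | F i (v w, z w)])//.
  rewrite measure_semi_bigcup//; last 3 first.
  - by move=> i; exact: mvzD.
  - move=> i j _ _ [w [Fi Fj]]; apply: (tF i j) => //.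
    by exists (v w, z w).
  - by apply: bigcup_measurable => i _; exact: mvzD.
  under [RHS]eq_integral => w _.
    rewrite xsection_bigcup measure_semi_bigcup//; last 3 first.
    - by move=> i; exact: measurable_xsection.
    - by apply: trivIset_xsection.
    - by apply: bigcup_measurable => i _; exact: measurable_xsection.
    over.
  rewrite integral_nneseries//; last by move=> i; exact: mk.
  apply: eq_eseriesr => i _; exact: QF.
Qed.

Lemma ae_disintegration (D : set (T * Z)) : measurable D ->
  (forall b, k b (xsection D b) = 1%E) -> {ae P, forall w, D (v w, z w)}.
Proof.
move=> mD kD; exists [set w | ~ D (v w, z w)]; split => //.
- rewrite (_ : mkset _ = [set w | (~` D) (v w, z w)])//.
  rewrite -[X in measurable X]setTI.
  exact: (measurable_fun_pair mv mz) (measurableC mD).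
- rewrite (_ : mkset _ = [set w | (~` D) (v w, z w)])//.
  rewrite probability_disintegration; last exact: measurableC.
  apply: integral0_eq => w _.
  have mDw : measurable (xsection D (v w)) by exact: measurable_xsection.
  rewrite (_ : xsection _ _ = ~` xsection D (v w)); last by rewrite !xsectionE.
  have : (k (v w) (~` xsection D (v w)) + k (v w) (xsection D (v w)) = 1)%E.
    rewrite -measureU//; [|exact: measurableC|by rewrite setICl].
    by rewrite setUC setUv; exact: prob_kernel.
  rewrite kD => h; rewrite -[LHS](@addeK _ 1%E)// h.
  exact: subee.
Qed.

End Disintegration.

(** * Worldviews and the controlled process *)

Section WorldviewMeasurability.
Context {R : realType} {n : nat}.
Implicit Types (a b : worldview R n) (f : worldview R n -> R).

Lemma weight_continuous j : continuous (fun a : worldview R n => weight a j).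
Proof.
move=> a; apply: (@continuous_comp (worldview R n) _ _ set_val
  (fun v : 'rV[R]_n.+1 => v 0 j)).
  exact: (@initial_continuous (worldview R n) _ set_val).
exact: coord_continuous.
Qed.

Lemma continuous_borel f : continuous f -> measurable_fun setT f.
Proof.
move=> /continuousP cf; apply: (measurability _ (RGenOpens.measurableE R)).
move=> _ [_ [x [y ->] <-]]; rewrite setTI.
by apply: sub_sigma_algebra; apply: cf; exact: interval_open.
Qed.

Lemma weight_ge0 a j : 0 <= weight a j.
Proof. by have [a0 _] := set_mem (svalP a); exact: a0. Qed.

Lemma sum_weight a : \sum_j weight a j = 1.
Proof. by have [_ a1] := set_mem (svalP a); exact: a1. Qed.

Lemma weight_le1 a j : weight a j <= 1.
Proof.
rewrite -(sum_weight a) (bigD1 j)//= lerDl sumr_ge0// => i _; exact: weight_ge0.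
Qed.

Lemma weight_inj a b : (forall j, weight a j = weight b j) -> a = b.
Proof.
move=> ab; apply: (@val_inj _ _ (set_type (simplex R n))); apply/rowP => j.
by rewrite -[LHS]/(weight a j) ab.
Qed.

Lemma weight_bounded_measurable j :
  bounded_measurable (fun a : worldview R n => weight a j).
Proof.
split; first exact: (continuous_borel (@weight_continuous j)).
by exists 1 => a; rewrite (ger0_norm (weight_ge0 a j)); exact: weight_le1.
Qed.

Lemma measurable_worldview1 a : measurable [set a].
Proof.
rewrite (_ : [set a] = \bigcap_(j in [set: 'I_n.+1])
    ((fun b => weight b j) @^-1` [set weight a j])); last first.
  apply/seteqP; split => b /=; first by move=> -> j _.
  by move=> h; apply: weight_inj => j; exact: h.
apply: fin_bigcap_measurable => // j _; rewrite -[X in measurable X]setTI.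
by have [mw _] := weight_bounded_measurable j; exact: mw.
Qed.

Context {X : finPointedType} (u : 'I_n.+1 -> X -> R).

Lemma U_bounded_measurable x : bounded_measurable (fun a : worldview R n => U u a x).
Proof.
apply: bounded_measurable_sum => j; apply: bounded_measurableM.
  exact: weight_bounded_measurable.
exact: bounded_measurable_cst.
Qed.

Lemma U_le_h a x : U u a x <= h u a.
Proof. by rewrite /h; apply: le_bigmax. Qed.

Lemma h_zstar a x : zstar u a x -> h u a = U u a x.
Proof.
move=> zx; apply/eqP; rewrite eq_le U_le_h andbT.
by apply: bigmax_le => [|y _]; exact: zx.
Qed.

Lemma zstar_h a x : U u a x = h u a -> zstar u a x.
Proof. by move=> e y; rewrite e; exact: U_le_h. Qed.

Lemma zstar_nonempty a : exists x, zstar u a x.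
Proof.
exists [arg max_(x > point) U u a x]%O => y.
by case: arg_maxP => // x _; exact.
Qed.

Lemma h_bounded_measurable : bounded_measurable (h u : worldview R n -> R).
Proof.
have bU := U_bounded_measurable.
split.
  rewrite (_ : h u = fun a => \big[Num.max/U u a point]_(x <- index_enum X) U u a x)//.
  elim: (index_enum X) => [|x s ih].
    by under eq_fun do rewrite big_nil; case: (bU point).
  under eq_fun do rewrite big_cons.
  by apply: measurable_maxr => //; case: (bU x).
exists (\sum_x \sum_j `|u j x|) => a; have [x zx] := zstar_nonempty a.
rewrite (h_zstar zx) (bigD1 x)//=.
apply: (@le_trans _ _ (\sum_j `|u j x|)).
  apply: (le_trans (ler_norm_sum _ _ _)); apply: ler_sum => j _.
  by rewrite normrM ler_piMl// ger0_norm ?weight_ge0// weight_le1.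
by rewrite lerDl; apply: sumr_ge0 => y _; exact: sumr_ge0.
Qed.

Lemma measurable_zstar x : measurable [set a | zstar u a x].
Proof.
rewrite (_ : [set a | _] = (fun a => U u a x - h u a) @^-1` [set 0]).
  rewrite -[X in measurable X]setTI.
  have [mU _] := U_bounded_measurable x; have [mh _] := h_bounded_measurable.
  exact: (measurable_funB mU mh).
apply/seteqP; split => a /=.
  by move=> /h_zstar ->; rewrite subrr.
by move=> /subr0_eq /zstar_h.
Qed.

End WorldviewMeasurability.

(** * The chain of worldviews under a realization *)

Section Process.
Context {R : realType} {n : nat} {X : finPointedType}.
Variables (Pi : strategy R n X) (M : realization Pi).
Local Notation T := (worldview R n).
Local Notation Z := (discr X * worldview R n)%type.

Lemma measurable_next t :
  measurable_fun setT (fun w : Omega M => (act M t w, view M t.+1 w) : Z).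
Proof. exact: measurable_fun_pair. Qed.

(** The event that [view M t] lies in [A] belongs to the history up to date t, so each transition
    satisfies the hypothesis [Pvz] of the disintegration. *)
Lemma view_act_transition (b : T) t (A : set T) (B : set Z) :
  measurable A -> measurable B ->
  (Pr M b (view M t @^-1` A `&` (fun w => (act M t w, view M t.+1 w)) @^-1` B) =
  \int[Pr M b]_(w in view M t @^-1` A) Pi (view M t w) B)%E.
Proof.
move=> mA mB; rewrite -realize_trans//.
apply: sub_sigma_algebra; left; exists t => //=.
by exists A => //; rewrite setTI.
Qed.

(** The Markov operator of [kappa], integrated against [Pi b] itself so that no image measure has to
    be carried along. *)
Definition Kop (f : T -> R) (b : T) : R := \int[Pi b]_z f z.2.

Lemma Kop_bounded_measurable f : bounded_measurable f -> bounded_measurable (Kop f).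
Proof.
move=> bf; apply: kernel_Rintegral.
by apply: (bounded_measurable_comp _ bf); exact: measurable_snd.
Qed.

Lemma iter_Kop_bounded_measurable k f :
  bounded_measurable f -> bounded_measurable (iter k Kop f).
Proof. by move=> bf; elim: k => //= k; exact: Kop_bounded_measurable. Qed.

Lemma iter_Kop_le f K k b : bounded_measurable f -> (forall a, `|f a| <= K) ->
  `|iter k Kop f b| <= K.
Proof.
move=> bf fK; elim: k b => //= k ih b.
apply: (le_normr_Rintegral_cst (prob_kernel b)); last by move=> z; exact: ih.
apply: (@bounded_measurable_comp _ _ _ _ _ snd (iter k Kop f)).
  exact: measurable_snd.
exact: iter_Kop_bounded_measurable.
Qed.

Lemma expectation_step (b : T) t (g : Z -> R) : bounded_measurable g ->
  \int[Pr M b]_w g (act M t w, view M t.+1 w) =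
  \int[Pr M b]_w \int[Pi (view M t w)]_z g z.
Proof.
move=> bg.
apply: (Rintegral_disintegration (k := Pi) (z := fun w => (act M t w, view M t.+1 w))) => //.
  exact: measurable_next.
exact: view_act_transition.
Qed.

Lemma expectation_view (b : T) k f : bounded_measurable f ->
  \int[Pr M b]_w f (view M k w) = iter k Kop f b.
Proof.
elim: k f => [|k ih] f bf.
  rewrite /= -[RHS](Rintegral_probability_cst (probability_setT (Pr M b))).
  congr fine; apply: ae_eq_integral => //.
  - apply/measurable_EFinP; apply: measurableT_comp => //; by case: bf.
  - have m0 : measurable (view M 0 @^-1` [set b]).
      rewrite -[X in measurable X]setTI.
      by apply: measurable_funP => //; exact: measurable_worldview1.
    exists (~` (view M 0 @^-1` [set b])); split.
    + exact: measurableC.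
    + have : Pr M b (~` (view M 0 @^-1` [set b])) = 0%E.
        by rewrite probability_setC// realize_init subee.
      exact.
    + by move=> w /=; apply: contra_not => ->.
(* The last transition turns [f] at date k+1 into [Kop f] at date k, hence the induction over all
   [f] at once. *)
rewrite iterSr -ih; last exact: Kop_bounded_measurable.
rewrite -(@expectation_step b k (fun z => f z.2))//.
by apply: (bounded_measurable_comp _ bf); exact: measurable_snd.
Qed.

Lemma ae_step (D : set (T * Z)) : measurable D ->
  (forall a, Pi a (xsection D a) = 1%E) ->
  forall b, {ae Pr M b, forall w, forall t,
    D (view M t w, (act M t w, view M t.+1 w))}.
Proof.
move=> mD PiD b.
apply/ae_foralln => t.
apply: (ae_disintegration (k := Pi) (z := fun w => (act M t w, view M t.+1 w))) => //.
  exact: measurable_next.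
exact: view_act_transition.
Qed.

End Process.

(** * Equilibrium values *)

Section Values.
Context {R : realType} {n : nat} {X : finPointedType}.
Variables (delta lambda : R) (u : 'I_n.+1 -> X -> R) (Pi : strategy R n X).
Hypothesis d01 : 0 < delta < 1.
Local Notation T := (worldview R n).
Local Notation Z := (discr X * worldview R n)%type.

(** The discounted resolvent of the chain: by [expectation_view], the expected discounted sum of [f]
    over the worldviews visited from [b]. *)
Definition Vop (f : T -> R) (b : T) : R := discount delta (fun k => iter k (Kop Pi) f b).

Lemma Vop_bounded_measurable f : bounded_measurable f -> bounded_measurable (Vop f).
Proof.
move=> bf; have [_ [K fK]] := bf.
apply: (@bounded_measurable_discount _ _ _ _ _ K) => // [k|k b].
  by have [] := iter_Kop_bounded_measurable Pi k bf.
exact: iter_Kop_le.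
Qed.

Lemma Vop_rec f b : bounded_measurable f -> Vop f b = f b + delta * Kop Pi (Vop f) b.
Proof.
move=> bf; have [_ [K fK]] := bf.
rewrite {1}/Vop (@discount_rec _ _ d01 _ K); last by move=> k; exact: iter_Kop_le.
(* Dominated convergence exchanges the first transition with the discounted sum. *)
congr (_ + _ * _); rewrite [RHS]/Kop.
rewrite -(@Rintegral_discount _ _ _ _ (prob_kernel b) _
  (fun k (z : Z) => iter k (Kop Pi) f z.2) K) => // [k|k z].
  have [mk _] := iter_Kop_bounded_measurable Pi k bf.
  exact: (measurableT_comp mk measurable_snd).
exact: iter_Kop_le.
Qed.

Lemma act_bounded_measurable (phi : X -> R) :
  bounded_measurable (fun z : Z => phi z.1).
Proof.
apply: (@bounded_measurable_comp _ _ _ _ _ (fst : Z -> discr X) (phi : discr X -> R)).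
  exact: measurable_fst.
split; first by [].
exists (\sum_x `|phi x|) => x; rewrite (bigD1 (x : X))//= lerDl.
exact: sumr_ge0.
Qed.

Definition ubar j (b : T) : R := \int[Pi b]_z u j z.1.

(** Here [a] judges the action that [b] plays. *)
Definition Ubar (a b : T) : R := \int[Pi b]_z U u a z.1.

Lemma ubar_bounded_measurable j : bounded_measurable (ubar j).
Proof. exact: (kernel_Rintegral Pi (act_bounded_measurable (u j))). Qed.

Lemma Ubar_sum a b : Ubar a b = \sum_j weight a j * ubar j b.
Proof.
rewrite /Ubar /U (Rintegral_sum (prob_kernel b)); last first.
  by move=> j; exact/bounded_measurableZ/act_bounded_measurable.
apply: eq_bigr => j _; rewrite RintegralZl//.
exact: (bounded_measurable_integrable (prob_kernel b) (act_bounded_measurable (u j))).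
Qed.

(** [Aval] accumulates the payoffs of the acting worldviews, with [h] standing for U(a_k, x_k);
    [Wval j] accumulates u_j(x_k). The judge [a] enters [Cval] through its weights only. [TC b a] is
    the mean value, judged by [a], of the state to which [b] moves. *)
Definition Aval : T -> R := Vop (h u).
Definition Wval j : T -> R := Vop (ubar j).
Definition Cval (c a : T) : R :=
  (1 - lambda) * Aval c + lambda * \sum_j weight a j * Wval j c.
Definition TC (b a : T) : R := Kop Pi (Cval^~ a) b.
Definition Sval (a : T) : R := TC a a.

Lemma Aval_bounded_measurable : bounded_measurable Aval.
Proof. exact/Vop_bounded_measurable/h_bounded_measurable. Qed.

Lemma Wval_bounded_measurable j : bounded_measurable (Wval j).
Proof. exact/Vop_bounded_measurable/ubar_bounded_measurable. Qed.

Lemma Cval_bounded_measurable a : bounded_measurable (Cval^~ a).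
Proof.
apply: bounded_measurableD; apply: bounded_measurableZ.
  exact: Aval_bounded_measurable.
apply: bounded_measurable_sum => j; apply: bounded_measurableZ.
exact: Wval_bounded_measurable.
Qed.

(** Keeping the moving state [b] apart from the judge [a] shows that [TC b] is affine in [a]; the
    continuity of S and the halving argument both start from this form. *)
Lemma TC_sum b a :
  TC b a = (1 - lambda) * Kop Pi Aval b + lambda * \sum_j weight a j * Kop Pi (Wval j) b.
Proof.
have bsnd (f : T -> R) : bounded_measurable f -> bounded_measurable (fun z : Z => f z.2).
  by move=> bf; apply: (bounded_measurable_comp _ bf); exact: measurable_snd.
have bA := bsnd _ Aval_bounded_measurable.
have bW j := bsnd _ (Wval_bounded_measurable j).
have pb := prob_kernel (s := Pi) b.
have bs : bounded_measurable (fun z : Z => \sum_j weight a j * Wval j z.2).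
  by apply: bounded_measurable_sum => j; exact: bounded_measurableZ.
rewrite /TC /Kop /Cval RintegralD//; last 2 first.
- exact: (bounded_measurable_integrable pb (bounded_measurableZ _ bA)).
- exact: (bounded_measurable_integrable pb (bounded_measurableZ _ bs)).
congr (_ + _).
  by rewrite RintegralZl//; exact: (bounded_measurable_integrable pb bA).
rewrite RintegralZl//; last exact: (bounded_measurable_integrable pb bs).
congr (_ * _); rewrite (Rintegral_sum pb); last by move=> j; exact: bounded_measurableZ.
apply: eq_bigr => j _; rewrite RintegralZl//.
exact: (bounded_measurable_integrable pb (bW j)).
Qed.

Lemma Cval_rec b a :
  Cval b a = (1 - lambda) * h u b + lambda * Ubar a b + delta * TC b a.
Proof.
rewrite TC_sum /Cval /Aval Vop_rec; last exact: h_bounded_measurable.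
under eq_bigr => j _.
  rewrite /Wval Vop_rec; last exact: ubar_bounded_measurable.
  rewrite mulrDr mulrCA; over.
rewrite big_split -mulr_sumr -Ubar_sum /=.
ring.
Qed.

Lemma Kop_Wval_bounded : exists2 K, 0 <= K & forall j b, `|Kop Pi (Wval j) b| <= K.
Proof.
have h j : exists K, forall b, `|Kop Pi (Wval j) b| <= K.
  by have [_] := Kop_bounded_measurable Pi (Wval_bounded_measurable j).
have /choice[K hK] := h.
have K0 j : 0 <= K j by rewrite (le_trans _ (hK j point)).
exists (\sum_j K j); first exact: sumr_ge0.
by move=> j b; rewrite (le_trans (hK j b))// (bigD1 j)//= lerDl sumr_ge0.
Qed.

Lemma Sval_bounded_measurable : bounded_measurable Sval.
Proof.
rewrite (_ : Sval = fun a => (1 - lambda) * Kop Pi Aval a +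
    lambda * \sum_j weight a j * Kop Pi (Wval j) a).
  2: by apply/funext => a; exact: TC_sum.
apply: bounded_measurableD; apply: bounded_measurableZ.
  exact/Kop_bounded_measurable/Aval_bounded_measurable.
apply: bounded_measurable_sum => j; apply: bounded_measurableM.
  exact: weight_bounded_measurable.
exact/Kop_bounded_measurable/Wval_bounded_measurable.
Qed.

Hypothesis s1 : forall a, s_marg Pi a (zstar u a) = 1%E.

Lemma Ubar_le a b K : (forall x, zstar u b x -> U u a x <= K) -> Ubar a b <= K.
Proof.
(* Off [zstar u b], a null event by [s1], the integrand is replaced by the bound, which then holds
   everywhere. *)
move=> hK; pose phi x := if `[< zstar u b x >] then U u a x else K.
rewrite /Ubar (_ : \int[Pi b]_z _ = \int[Pi b]_z phi z.1).
  apply: (Rintegral_le_cst (prob_kernel b)); first exact: act_bounded_measurable.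
  by move=> z; rewrite /phi; case: asboolP => // /hK.
apply: eq_ae_Rintegral.
- by case: (act_bounded_measurable (U u a)).
- by case: (act_bounded_measurable phi).
have mz : measurable ((fst : Z -> discr X) @^-1` zstar u b).
  by rewrite -[X in measurable X]setTI; exact: measurable_fst.
have /(measure1_ae (prob_kernel b) mz)[N [mN N0 sN]] := s1 b.
exists N; split => // z /= hz; apply: sN => /= zz; apply: hz.
by rewrite /phi asboolT.
Qed.

Lemma Ubar_ge a b K : (forall x, zstar u b x -> K <= U u a x) -> K <= Ubar a b.
Proof.
move=> hK; pose phi x := if `[< zstar u b x >] then - U u a x else - K.
rewrite -lerN2 -mulN1r /Ubar -RintegralZl//; last first.
  exact: (bounded_measurable_integrable (prob_kernel b) (act_bounded_measurable (U u a))).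
rewrite (_ : \int[Pi b]_z _ = \int[Pi b]_z phi z.1).
  apply: (Rintegral_le_cst (prob_kernel b)); first exact: act_bounded_measurable.
  by move=> z; rewrite /phi; case: asboolP => // /hK; rewrite lerN2.
apply: eq_ae_Rintegral.
- by case: (act_bounded_measurable (fun x => -1 * U u a x)).
- by case: (act_bounded_measurable phi).
have mz : measurable ((fst : Z -> discr X) @^-1` zstar u b).
  by rewrite -[X in measurable X]setTI; exact: measurable_fst.
have /(measure1_ae (prob_kernel b) mz)[N [mN N0 sN]] := s1 b.
exists N; split => // z /= hz; apply: sN => /= zz; apply: hz.
by rewrite /phi asboolT// mulN1r.
Qed.

(** * Realized payoffs and optimality along almost every path *)

Section Realized.
Variable M : realization Pi.

Lemma ae_act_zstar b : {ae Pr M b, forall w, forall t, zstar u (view M t w) (act M t w)}.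
Proof.
pose D : set (T * Z) := [set y | zstar u y.1 y.2.1].
apply: (@ae_step _ _ _ _ M D).
  (* With finitely many actions, measurability reduces to that of the set of worldviews at which a
     given action is optimal. *)
  rewrite (_ : D = \bigcup_(x in [set: X])
      ([set a | zstar u a x] `*` ((fst : Z -> discr X) @^-1` [set x]))).
    apply: fin_bigcup_measurable => // x _; apply: measurableX.
      exact: measurable_zstar.
    by rewrite -[X in measurable X]setTI; exact: measurable_fst.
  apply/seteqP; split => [[a [x c]] /= hx|[a [x c]] [x' _ [/= ? ->]]] //.
  by exists x.
move=> a; rewrite -[RHS](s1 a) /s_marg /pushforward; congr (Pi a _).
by rewrite xsectionE.
Qed.

Lemma expectation_act b k (phi : X -> R) :
  \int[Pr M b]_w phi (act M k w) = iter k (Kop Pi) (fun c => \int[Pi c]_z phi z.1) b.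
Proof.
rewrite -(expectation_view M); last first.
  exact: (kernel_Rintegral Pi (act_bounded_measurable phi)).
exact: (expectation_step M b k (act_bounded_measurable phi)).
Qed.

(** Almost surely the stage payoff equals its version with [h]; expectation and discounted sum are
    exchanged, and the expectation at date k becomes the k-th iterate of [Kop]. The payoff thus
    depends on [Pi] and not on its realization. *)
Lemma Cpay_Cval b a : Cpay delta lambda u M b a = (Cval b a)%:E.
Proof.
pose c k w := stage_payoff lambda u a (view M k w) (act M k w).
have P1 := probability_setT (Pr M b).
have bview k (f : T -> R) : bounded_measurable f -> bounded_measurable (fun w : Omega M => f (view M k w)).
  by move=> bf; exact: bounded_measurable_comp bf.
have bact k (phi : X -> R) : bounded_measurable (fun w : Omega M => phi (act M k w)).
  have := bounded_measurable_comp (measurable_next (M := M) k) (act_bounded_measurable phi).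
  exact.
have bU k : bounded_measurable (fun w : Omega M => U u a (act M k w)) by exact: (bact k (U u a)).
have bhv k : bounded_measurable (fun w : Omega M => h u (view M k w)).
  exact: (bview k _ (h_bounded_measurable u)).
have mc k : measurable_fun setT (c k).
  apply: (bounded_measurableD _ (bounded_measurableZ lambda (bU k))).1.
  apply: bounded_measurableZ; apply: bounded_measurable_sum => j.
  apply: bounded_measurableM; first exact: (bview k _ (weight_bounded_measurable j)).
  exact: (bact k (u j)).
pose K := \sum_x \sum_j `|u j x|.
have UK a' x : `|U u a' x| <= K.
  rewrite /K (bigD1 x)//= (@le_trans _ _ (\sum_j `|u j x|))//; last first.
    by rewrite lerDl; apply: sumr_ge0 => y _; exact: sumr_ge0.
  apply: (le_trans (ler_norm_sum _ _ _)); apply: ler_sum => j _.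
  by rewrite normrM ler_piMl// ger0_norm ?weight_ge0// weight_le1.
pose K' := `|1 - lambda| * K + `|lambda| * K.
have cK k w : `|c k w| <= K'.
  rewrite (le_trans (ler_normD _ _))// !normrM lerD// ler_wpM2l//; exact: UK.
have bd := bounded_measurable_discount d01 mc cK.
rewrite /Cpay unlock -[LHS]/(\int[Pr M b]_w (discount delta (c ^~ w))%:E)%E.
rewrite -(EFin_Rintegral P1)//; congr EFin.
rewrite (Rintegral_discount P1 d01 mc cK).
have bh := h_bounded_measurable u (n := n).
have ck k : \int[Pr M b]_w c k w = (1 - lambda) * iter k (Kop Pi) (h u) b +
    \sum_j lambda * weight a j * iter k (Kop Pi) (ubar j) b.
  rewrite (_ : \int[_]_w c k w =
      \int[Pr M b]_w ((1 - lambda) * h u (view M k w) + lambda * U u a (act M k w))).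
    rewrite RintegralD//; last 2 first.
    - exact: (bounded_measurable_integrable P1 (bounded_measurableZ _ (bhv k))).
    - exact: (bounded_measurable_integrable P1 (bounded_measurableZ _ (bU k))).
    rewrite (RintegralZl _ measurableT (bounded_measurable_integrable P1 (bhv k))).
    rewrite (RintegralZl _ measurableT (bounded_measurable_integrable P1 (bU k))).
    rewrite (expectation_view M b k bh); congr (_ + _).
    rewrite /U (Rintegral_sum P1); last first.
      by move=> j; apply: bounded_measurableZ; exact: (bact k (u j)).
    rewrite mulr_sumr; apply: eq_bigr => j _; rewrite -mulrA; congr (_ * _).
    rewrite RintegralZl//; last exact: (bounded_measurable_integrable P1 (bact k (u j))).
    by rewrite (expectation_act b k (u j)).
  apply: eq_ae_Rintegral; first exact: mc.
    by case: (bounded_measurableD (bounded_measurableZ (1 - lambda) (bhv k))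
      (bounded_measurableZ lambda (bU k))).
  have [N [mN N0 sN]] := ae_act_zstar b.
  exists N; split => // w /= hw; apply: sN => /= hz; apply: hw.
  by rewrite /c /stage_payoff (h_zstar (hz k)).
under eq_fun do rewrite ck.
have [_ [Kh hKh]] := bh.
have /choice[Ku hKu] : forall j, exists K0, forall c0, `|ubar j c0| <= K0.
  by move=> j; have [_] := ubar_bounded_measurable j.
have Bh k : `|iter k (Kop Pi) (h u) b| <= Kh by exact: iter_Kop_le.
have Bu j k : `|iter k (Kop Pi) (ubar j) b| <= Ku j.
  by apply: iter_Kop_le => //; exact: ubar_bounded_measurable.
have BZ (r : R) (f : nat -> R) K0 : (forall k, `|f k| <= K0) ->
    forall k, `|r * f k| <= `|r| * K0.
  by move=> fK k; rewrite normrM ler_wpM2l.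
have Bsum (s : seq 'I_n.+1) k : `|\sum_(j <- s) lambda * weight a j * iter k (Kop Pi) (ubar j) b|
    <= \sum_(j <- s) `|lambda * weight a j| * Ku j.
  apply: (le_trans (ler_norm_sum _ _ _)); apply: ler_sum => j _.
  exact: (BZ _ (fun k => iter k (Kop Pi) (ubar j) b)).
rewrite (discountD d01 (BZ _ _ _ Bh) (Bsum _)) (discountZ d01 _ Bh).
congr (_ + _); rewrite mulr_sumr.
(* The empty sum is rewritten as 0 times a bounded sequence, so that [discountZ] settles it. *)
elim: (index_enum _) Bsum => [|j s ih] Bsum.
  rewrite big_nil; under eq_fun do rewrite big_nil.
  rewrite (_ : (fun=> 0) = (fun k => 0 * iter k (Kop Pi) (h u) b)).
    by rewrite (discountZ d01 _ Bh) mul0r.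
  by apply/funext => k; rewrite mul0r.
under eq_fun do rewrite big_cons.
rewrite (discountD d01 (BZ _ _ _ (Bu j)) (Bsum s)) (discountZ d01 _ (Bu j)).
by rewrite big_cons ih// mulrA.
Qed.

Lemma Spay_Sval a : Spay delta lambda u M a = (Sval a)%:E.
Proof.
rewrite /Spay /kappa; under eq_integral do rewrite Cpay_Cval.
have bC := Cval_bounded_measurable a.
have bCs : bounded_measurable (fun z : Z => Cval z.2 a).
  by apply: (bounded_measurable_comp _ bC); exact: measurable_snd.
rewrite (integral_pushforward (mu := Pi a) (phi := snd)
  (f := fun c => (Cval c a)%:E) measurable_snd)//=; last 2 first.
- by apply/measurable_EFinP; case: bC.
- exact: (bounded_measurable_integrable (prob_kernel a) bCs).
by rewrite /Sval /TC /Kop (EFin_Rintegral (prob_kernel a)).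
Qed.

Hypothesis E : is_MPE delta lambda u M.

Lemma Cval_le_Sval c a : Cval c a <= Sval a.
Proof. by have [_ /(_ c)] := E a; rewrite Cpay_Cval Spay_Sval lee_fin. Qed.

Lemma TC_le_Sval b a : TC b a <= Sval a.
Proof.
apply: (Rintegral_le_cst (prob_kernel b)); last by move=> z; exact: Cval_le_Sval.
apply: (@bounded_measurable_comp _ _ _ _ _ (snd : Z -> T) (Cval ^~ a)).
  exact: measurable_snd.
exact: Cval_bounded_measurable.
Qed.

Lemma Pi_optimal a : {ae Pi a, forall z, Cval z.2 a = Sval a}.
Proof.
apply: (Rintegral_eq_upper_bound (prob_kernel a)) => //; last by move=> z; exact: Cval_le_Sval.
apply: (@bounded_measurable_comp _ _ _ _ _ (snd : Z -> T) (Cval ^~ a)).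
  exact: measurable_snd.
exact: Cval_bounded_measurable.
Qed.

(** The probabilistic input of the analysis of paths. [Pi_optimal] holds state by state; carrying it
    to paths requires [F] to be jointly measurable, which the expansion in the weights of the judge
    provides. *)
Lemma ae_view_optimal b : {ae Pr M b, forall w, forall t,
  Cval (view M t.+1 w) (view M t w) = Sval (view M t w)}.
Proof.
pose F (y : T * Z) := Cval y.2.2 y.1 - Sval y.1.
have b1 (f : T -> R) : bounded_measurable f -> bounded_measurable (fun y : T * Z => f y.1).
  by move=> bf; apply: (bounded_measurable_comp _ bf); exact: measurable_fst.
have b2 (f : T -> R) : bounded_measurable f -> bounded_measurable (fun y : T * Z => f y.2.2).
  move=> bf; apply: (@bounded_measurable_comp _ _ _ _ _ (fun y : T * Z => y.2.2) f) => //.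
  exact: (measurableT_comp measurable_snd measurable_snd).
have [mF _] : bounded_measurable F.
  apply: bounded_measurableD; last first.
    under eq_fun do rewrite -mulN1r.
    exact/bounded_measurableZ/b1/Sval_bounded_measurable.
  apply: bounded_measurableD; apply: bounded_measurableZ.
    exact/b2/Aval_bounded_measurable.
  apply: bounded_measurable_sum => j; apply: bounded_measurableM.
    exact: (b1 _ (weight_bounded_measurable j)).
  exact/b2/Wval_bounded_measurable.
have mD : measurable (F @^-1` [set 0]) by rewrite -[X in measurable X]setTI; exact: mF.
have [a|N [mN N0 sN]] := @ae_step _ _ _ _ M _ mD _ b.
  apply/(measure1_ae (prob_kernel a) (measurable_xsection _ mD)).
  have [N [mN N0 sN]] := Pi_optimal a.
  exists N; split => // z /= hz; apply: sN => /= e; apply: hz.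
  by rewrite xsectionE /= /F e subrr.
exists N; split => // w /= hw; apply: sN => /= h; apply: hw => t.
exact/subr0_eq/h.
Qed.

(** By [Pi_optimal], [kappa Pi a] is carried by the maximizers of C( . ; a). *)
Lemma absorbing_of_strict a : (forall c, c <> a -> Cval c a < Sval a) -> absorbing Pi a.
Proof.
move=> sa; rewrite /absorbing /kappa /pushforward.
have ma : measurable ((snd : Z -> T) @^-1` [set a]).
  by rewrite -[X in measurable X]setTI; apply: measurable_snd => //; exact: measurable_worldview1.
apply/(measure1_ae (prob_kernel a) ma).
have [N [mN N0 sN]] := Pi_optimal a.
exists N; split => // z /= hz; apply: sN => /= e.
by have := sa z.2 hz; rewrite e ltxx.
Qed.

Lemma absorbing_TC a a' : absorbing Pi a -> TC a a' = Cval a a'.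
Proof.
rewrite /absorbing /kappa /pushforward => ha.
have ma : measurable ((snd : Z -> T) @^-1` [set a]).
  by rewrite -[X in measurable X]setTI; apply: measurable_snd => //; exact: measurable_worldview1.
rewrite -[RHS](Rintegral_probability_cst (prob_kernel (s := Pi) a)).
apply: eq_ae_Rintegral.
- have [mC _] := Cval_bounded_measurable a'.
  exact: (measurableT_comp mC measurable_snd).
- exact: measurable_cst.
have /(measure1_ae (prob_kernel a) ma)[N [mN N0 sN]] := ha.
by exists N; split => // z /= hz; apply: sN => /= e; apply: hz; rewrite e.
Qed.

Lemma Zset_Sval a : Zset delta lambda u M a <-> (1 - delta) * Sval a = h u a.
Proof.
by rewrite /Zset /mkset Spay_Sval -EFinM; split => [[]|->].
Qed.

End Realized.
End Values.

(** * Topology of the simplex of worldviews *)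

Section CompactCluster.
Context {Y : topologicalType}.

(** Otherwise the filter of the sequence, restricted to the complement of [O], is proper and has a
    cluster point by compactness. This is a cluster point of the sequence too, so [O] is one of its
    neighbourhoods, which is absurd. *)
Lemma compact_cluster_near (b : nat -> Y) (O : set Y) : compact [set: Y] ->
  (forall y, cluster (b @ \oo) y -> nbhs y O) -> \forall t \near \oo, O (b t).
Proof.
move=> cY clO; apply: contrapT => nO.
pose F := within (~` O) (b @ \oo).
have FF : ProperFilter F.
  apply: Build_ProperFilter_ex => A FA; apply: contrapT => /forallNP A0; apply: nO.
  rewrite /F /within /= in FA.
  by apply: filterS FA => t h; apply: contrapT => /h /A0.
have [y [_ Fy]] := cY F FF filterT.
have yO : nbhs y O.
  apply: clO => A B FA nB; apply: Fy => //.
  exact: (@cvg_within _ (b @ \oo) _ (~` O)).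
have [z [Oz Oz']] : (~` O) `&` O !=set0.
  by apply: Fy => //; exact: withinT.
by [].
Qed.

Lemma cluster_cvg_eq {R : realType} (b : nat -> Y) (f : Y -> R) (l : R) y :
  continuous f -> f (b t) @[t --> \oo] --> l -> cluster (b @ \oo) y -> f y = l.
Proof.
move=> cf fl cy; apply/eqP; apply: contraT => fy.
have d0 : 0 < `|f y - l| / 2 by rewrite divr_gt0// normr_gt0 subr_eq0.
have [z []] : [set z | `|l - f z| < `|f y - l| / 2] `&`
    [set z | `|f y - f z| < `|f y - l| / 2] !=set0.
  apply: cy.
    by move/cvgrPdist_lt : fl; apply.
  by have /cvgrPdist_lt := cf y; apply.
move=> /= h1 h2.
suff : `|f y - l| < `|f y - l| by rewrite ltxx.
rewrite [ltRHS]splitr (le_lt_trans _ (ltrD h2 h1))//.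
by rewrite (distrC l) (le_trans _ (ler_normD _ _))// addrA subrK.
Qed.

End CompactCluster.

Section WorldviewTopology.
Context {R : realType} {n : nat}.
Local Notation T := (worldview R n).

Lemma nbhs_worldview (p : T) (A : set T) : nbhs p A <->
  exists2 e : R, 0 < e & forall a, (forall j, `|weight p j - weight a j| < e) -> A a.
Proof.
split=> [|[e e0 eA]]; last first.
  have : \forall a \near p, forall j, `|weight p j - weight a j| < e.
    apply: (@filter_forall _ _ (fun j a => `|weight p j - weight a j| < e) (nbhs p)) => j.
    by have /cvgrPdist_lt := @weight_continuous R n j p; apply.
  by apply: filterS => a; exact: eA.
rewrite nbhsE => -[B [oB Bp] BA].
case: oB => O oO OB.
have : nbhs (set_val p : 'rV[R]_n.+1) O.
  by apply: open_nbhs_nbhs; split => //; rewrite -OB in Bp.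
move=> /nbhs_ballP[e e0 eO]; exists e => // a ha; apply: BA; rewrite -OB.
by apply: eO; split=> // i j; rewrite ord1; exact: ha.
Qed.

Lemma cvg_worldview {S : Type} (F : set_system S) {FF : Filter F} (f : S -> T) (p : T) :
  (forall j, weight (f s) j @[s --> F] --> weight p j) -> f @ F --> p.
Proof.
move=> h A /nbhs_worldview[e e0 eA].
have : \forall s \near F, forall j, `|weight p j - weight (f s) j| < e.
  apply: (@filter_forall _ _ (fun j s => `|weight p j - weight (f s) j| < e) F) => j.
  by have /cvgrPdist_lt := h j; apply.
by apply: filterS => s; exact: eA.
Qed.

Lemma simplex_compact : compact (simplex R n).
Proof.
apply: (subclosed_compact _ (rV_compact (fun j : 'I_n.+1 => @segment_compact R 0 1))).
  rewrite (_ : simplex R n = (\bigcap_(j in [set: 'I_n.+1])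
      ((fun v : 'rV[R]_n.+1 => v 0 j) @^-1` [set x | 0 <= x])) `&`
      ((fun v : 'rV[R]_n.+1 => \sum_j v 0 j) @^-1` [set 1])); last first.
    apply/seteqP; split => v /=; first by move=> [v0 v1]; split => // j _; exact: v0.
    by move=> [v0 v1]; split => // j; exact: (v0 j I).
  apply: closedI.
    apply: closed_bigI => j _; apply: (continuous_closedP _).1; last exact: closed_ge.
    exact: coord_continuous.
  apply: (continuous_closedP _).1; last exact: closed_eq.
  apply: (continuous_big (op := +%R)) => [|j _]; first exact: add_continuous.
  exact: coord_continuous.
move=> v [v0 v1] j /=; rewrite in_itv/= v0 /= -v1 (bigD1 j)//= lerDl.
by rewrite sumr_ge0// => i _; exact: v0.
Qed.

Lemma worldview_compact : compact [set: T].
Proof.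
move=> F FF _.
pose G : set_system 'rV[R]_n.+1 := (set_val : T -> _) @ F.
have GF : ProperFilter G by exact: fmap_proper_filter.
have [|v [sv Gv]] := @simplex_compact G GF.
  by rewrite /G /fmap /=; near=> a; exact: set_mem (svalP a).
pose p : T := exist _ v (mem_set sv).
exists p; split => // A B FA /nbhs_worldview[e e0 eB].
have [_ [[a Aa <-] va]] : (set_val @` A) `&` ball v e !=set0.
  apply: Gv; last exact: nbhsx_ballx.
  by rewrite /G /fmap /=; apply: filterS FA => a Aa; exists a.
by exists a; split => //; apply: eB => j; exact: (va.2 0 j).
Unshelve. all: by end_near. Qed.

Lemma lipschitz_continuous (f : T -> R) K : 0 <= K ->
  (forall a b, f a - f b <= K * \sum_j `|weight a j - weight b j|) -> continuous f.
Proof.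
move=> K0 fK p; apply/(@cvgrPdist_lt _ _ _ (nbhs p)) => e e0.
(* [K + 1] stays positive when [K] is 0, and the error is shared among the n+1 coordinates. *)
have e1 : 0 < e / (K + 1) / n.+1%:R by rewrite !divr_gt0// ltr_wpDl.
have : \forall a \near p, forall j, `|weight p j - weight a j| < e / (K + 1) / n.+1%:R.
  apply: (@filter_forall _ _
    (fun j a => `|weight p j - weight a j| < e / (K + 1) / n.+1%:R) (nbhs p)) => j.
  by have /cvgrPdist_lt := @weight_continuous R n j p; apply.
apply: filterS => a ha.
have {ha}ha : \sum_j `|weight p j - weight a j| <= e / (K + 1).
  rewrite (@le_trans _ _ (\sum_(j < n.+1) (e / (K + 1) / n.+1%:R)))//.
    by apply: ler_sum => j _; exact/ltW.
  by rewrite sumr_const card_ord -[leLHS]mulr_natr divfK// pnatr_eq0.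
have h : K * (e / (K + 1)) < e.
  by rewrite mulrA ltr_pdivrMr ?ltr_wpDl// mulrC ltr_pM2l// ltrDl.
apply: le_lt_trans h; apply: (@le_trans _ _ (K * \sum_j `|weight p j - weight a j|)).
  rewrite ler_norml; apply/andP; split; last exact: fK.
  rewrite lerNl opprB (le_trans (fK _ _))//.
  by under eq_bigr do rewrite distrC.
by rewrite ler_wpM2l.
Qed.

Lemma weight_vertex (i j : 'I_n.+1) : weight (vertex R i) j = (i == j)%:R.
Proof. by rewrite /weight /= mxE eqxx /= eq_sym. Qed.

Lemma weight_eq1 (a : T) j : weight a j = 1 -> a = vertex R j.
Proof.
move=> aj; apply: weight_inj => i; rewrite weight_vertex.
have := sum_weight a; rewrite (bigD1 j)//= aj -[RHS]addr0 => /addrI/eqP.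
rewrite psumr_eq0 => [/allP h|k _]; last exact: weight_ge0.
have [<-//|ji] := eqVneq j i.
by apply/eqP; have := h i (mem_index_enum _); rewrite eq_sym ji.
Qed.

Context {X : finPointedType} (u : 'I_n.+1 -> X -> R).

Lemma U_continuous x : continuous (fun a : T => U u a x).
Proof.
apply: (continuous_big (op := +%R)) => [|j _ a]; first exact: add_continuous.
have := cvgM (@weight_continuous R n j a) (@cvg_cst _ (u j x) _ (nbhs a) _).
exact.
Qed.

Lemma h_continuous : continuous (h u : T -> R).
Proof.
pose K := \sum_x \sum_j `|u j x|.
apply: (@lipschitz_continuous _ K).
  by apply: sumr_ge0 => x _; exact: sumr_ge0.
move=> a b; have [x zx] := zstar_nonempty u a.
rewrite (h_zstar zx); apply: (@le_trans _ _ (U u a x - U u b x)).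
  by rewrite lerD2l lerN2 U_le_h.
rewrite /U -sumrB mulr_sumr; apply: ler_sum => j _.
rewrite -mulrBl (le_trans (ler_norm _))// normrM mulrC ler_wpM2r//.
rewrite /K (bigD1 x)//= (bigD1 j)//= -addrA lerDl.
by rewrite addr_ge0// ?sumr_ge0// => y _; rewrite sumr_ge0.
Qed.

(** Upper hemicontinuity: each strict inequality excluding an action at [p] persists nearby, and
    there are finitely many actions. *)
Lemma zstar_near (p : T) : \forall a \near p, zstar u a `<=` zstar u p.
Proof.
have : \forall a \near p, forall x, ~ zstar u p x -> ~ zstar u a x.
  apply: (@filter_forall _ _ (fun x a => ~ zstar u p x -> ~ zstar u a x) (nbhs p)) => x.
  have [zx|nzx] := pselect (zstar u p x); first exact: nearW.
  have /existsNP[y /negP] := nzx; rewrite -ltNge => xy.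
  have xy0 : 0 < U u p y - U u p x by rewrite subr_gt0.
  have : (fun a => U u a y - U u a x) @ p --> U u p y - U u p x.
    exact: (cvgB (@U_continuous y p) (@U_continuous x p)).
  move/cvgrPdist_lt => /(_ _ xy0); apply: filterS => a; rewrite ltr_norml => /andP[_ h] _.
  move=> /(_ y); rewrite leNgt => /negP; apply.
  by rewrite -subr_gt0; move: h; rewrite ltrBlDr ltrDl.
by apply: filterS => a h x zx; apply: contrapT => /h.
Qed.

End WorldviewTopology.

(** * Dynamics along equilibrium paths *)

Section Dynamics.
Context {R : realType} {n : nat} {X : finPointedType}.
Variables (delta lambda : R) (u : 'I_n.+1 -> X -> R).
Variables (Pi : strategy R n X) (M : realization Pi).
Hypotheses (d01 : 0 < delta < 1) (l01 : 0 < lambda < 1).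
Hypothesis E : is_MPE delta lambda u M.
Local Notation T := (worldview R n).
Local Notation C := (Cval delta lambda u Pi).
Local Notation K := (TC delta lambda u Pi).
Local Notation S := (Sval delta lambda u Pi).
Local Notation F := (fun a => (1 - delta) * S a).
Local Notation UB := (Ubar u Pi).

Let s1 a : s_marg Pi a (zstar u a) = 1%E := (E a).1.
Let Cle c a : C c a <= S a := Cval_le_Sval d01 s1 E c a.
Let Kle b a : K b a <= S a := TC_le_Sval d01 s1 E b a.
Let Crec b a : C b a = (1 - lambda) * h u b + lambda * UB a b + delta * K b a :=
  Cval_rec lambda u Pi d01 b a.
Let UB_le a b := @Ubar_le _ _ _ _ _ s1 a b.
Let UB_ge a b := @Ubar_ge _ _ _ _ _ s1 a b.

Let UB_le_h a b : UB a b <= h u a.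
Proof. by apply: UB_le => x _; exact: U_le_h. Qed.

Let UB_diag a : UB a a = h u a.
Proof.
apply/eqP; rewrite eq_le UB_le_h; apply: UB_ge => x zx.
by rewrite (h_zstar zx).
Qed.

Let UB_lt a b r : (forall x, zstar u b x -> U u a x < r) -> UB a b < r.
Proof.
move=> hr; have [x0 zx0] := zstar_nonempty u b.
(* Strictness survives averaging because the finite set [zstar u b] contains an action that is best
   for [a]. *)
pose x1 := [arg max_(x > x0 | `[< zstar u b x >]) U u a x]%O.
have [zx1 hx1] : zstar u b x1 /\ forall x, zstar u b x -> U u a x <= U u a x1.
  rewrite /x1; case: arg_maxP; first exact/asboolP.
  by move=> x /asboolP zx hx; split => // y zy; apply: hx; exact/asboolP.
exact: le_lt_trans (UB_le hx1) (hr _ zx1).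
Qed.

(** Starting again from [a] is worth h(a) + delta S(a) to [a], since [TC a a] is S(a); equilibrium
    bounds this by S(a). *)
Lemma h_le_S a : h u a <= (1 - delta) * S a.
Proof. by have := Cle a a; rewrite Crec UB_diag -/(S a); lra. Qed.

Lemma step_le a c : C c a = S a ->
  (1 - delta) * S a <= (1 - lambda) * h u c + lambda * UB a c.
Proof.
have /andP[d0 _] := d01.
move=> e; have := Crec c a; rewrite e => e'.
have := ler_wpM2l (ltW d0) (Kle c a); lra.
Qed.

(** In [step_le], h(c) is bounded by (1 - delta) S(c) and [UB a c] by h(a); then (1 - delta) S(a) is
    split in the proportions 1 - lambda and lambda. *)
Lemma step_gap a c : C c a = S a ->
  lambda * ((1 - delta) * S a - h u a) <= (1 - lambda) * (1 - delta) * (S c - S a).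
Proof.
have /andP[l0 l1] := l01.
move=> /step_le h1; have h2 := ler_wpM2l (ltW l0) (UB_le_h a c).
have h3 : (1 - lambda) * h u c <= (1 - lambda) * ((1 - delta) * S c).
  by rewrite ler_wpM2l ?h_le_S// subr_ge0 ltW.
nra.
Qed.

Lemma S_continuous : continuous S.
Proof.
have /andP[l0 l1] := l01.
have [B B0 hB] := Kop_Wval_bounded u Pi d01.
apply: (@lipschitz_continuous _ _ _ (lambda * B)); first by rewrite mulr_ge0// ltW.
(* Both judges are compared along the transition of [a], using [TC a b <= S b]. *)
move=> a b; apply: (@le_trans _ _ (K a a - K a b)); first by rewrite lerD2l lerN2.
rewrite !(TC_sum _ _ _ d01) opprD addrACA subrr add0r -mulrBr -mulrA ler_wpM2l ?(ltW l0)//.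
rewrite -sumrB mulr_sumr; apply: ler_sum => j _.
rewrite -mulrBl mulrC (le_trans (ler_norm _))// normrM ler_wpM2r//.
Qed.

Let G a := (1 - delta) * S a - h u a.

Let G_ge0 a : 0 <= G a. Proof. by rewrite subr_ge0 h_le_S. Qed.

Let F_continuous : continuous (fun a => (1 - delta) * S a).
Proof. move=> a; exact: (cvgM (@cvg_cst _ (1 - delta) _ (nbhs a) _) (@S_continuous a)). Qed.

Let G_continuous : continuous G.
Proof. move=> a; exact: (cvgB (@F_continuous a) (@h_continuous R n X u a)). Qed.

Lemma Zset_gap a : Zset delta lambda u M a <-> G a = 0.
Proof.
apply: (iff_trans (Zset_Sval lambda d01 s1 M a)).
by rewrite /G; split=> [->|/subr0_eq//]; exact: subrr.
Qed.

(** * Paths along which every move is optimal *)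

Section Path.
Variable a : nat -> T.
Hypothesis aC : forall t, C (a t.+1) (a t) = S (a t).

Let S_nd t : S (a t) <= S (a t.+1).
Proof.
have /andP[l0 l1] := l01; have /andP[d0 d1] := d01.
rewrite -subr_ge0 -(@pmulr_rge0 _ ((1 - lambda) * (1 - delta))).
  by apply: le_trans (step_gap (aC t)); rewrite mulr_ge0 ?(ltW l0)//; exact: G_ge0.
by rewrite mulr_gt0// subr_gt0.
Qed.

Lemma S_path_cvg : cvgn (fun t => S (a t)).
Proof.
apply: nondecreasing_is_cvgn; first by apply/nondecreasing_seqP; exact: S_nd.
have [_ [B hB]] := Sval_bounded_measurable lambda u Pi d01.
by exists B => _ [t _ <-]; exact: le_trans (ler_norm _) (hB _).
Qed.

Lemma gap_path_cvg0 : G (a t) @[t --> \oo] --> 0.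
Proof.
have /andP[l0 l1] := l01.
pose B t := (1 - lambda) * (1 - delta) / lambda * (S (a t.+1) - S (a t)).
have B0 : B @ \oo --> 0.
  rewrite -(mulr0 ((1 - lambda) * (1 - delta) / lambda)).
  apply: cvgM; first exact: cvg_cst.
  rewrite -(subrr (limn (fun t => S (a t)))).
  apply: cvgB; last exact: S_path_cvg.
  have := S_path_cvg; rewrite -[X in X --> _]/((fun t => S (a t.+1)) @ \oo).
  by move=> cv; rewrite (cvg_shiftS (fun t => S (a t))).
apply: (@squeeze_cvgr _ _ _ _ (fun=> 0) B) => //; last exact: cvg_cst.
apply: nearW => t; rewrite G_ge0 /= /B mulrAC ler_pdivlMr// mulrC.
exact: step_gap.
Qed.

Lemma cluster_path_Zset : cluster (a @ \oo) `<=` Zset delta lambda u M.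
Proof.
move=> p cp; apply/Zset_gap.
exact: (cluster_cvg_eq G_continuous gap_path_cvg0 cp).
Qed.

End Path.

(** The segment from [p] to vertex [i], as a total function of [e]: outside [0, 1] the formula may
    leave the simplex, and [p] is returned instead. *)
Lemma toward_vertex (p : T) (i : 'I_n.+1) : exists al : R -> T,
  forall e, 0 <= e <= 1 -> forall j, weight (al e) j = (1 - e) * weight p j + e * (i == j)%:R.
Proof.
suff /choice[al hal] : forall e : R, exists b : T, 0 <= e <= 1 ->
    forall j, weight b j = (1 - e) * weight p j + e * (i == j)%:R by exists al.
move=> e; have [e01|_] := boolP (0 <= e <= 1); last by exists p.
have /andP[e0 e1] := e01.
pose v : 'rV[R]_n.+1 := \row_j ((1 - e) * weight p j + e * (i == j)%:R).
have sv : simplex R n v.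
  split=> [j|].
    by rewrite mxE addr_ge0// mulr_ge0// ?weight_ge0// subr_ge0.
  under eq_bigr do rewrite mxE.
  rewrite big_split/= -!mulr_sumr sum_weight.
  rewrite (bigD1 i)//= eqxx big1 ?addr0 ?mulr1 ?subrK// => j ji.
  by rewrite eq_sym (negbTE ji).
by exists (exist _ v (mem_set sv)) => _ j; rewrite /weight /= mxE.
Qed.

(* Moving from [p] towards vertex [i], the optimal continuation loses at least
   a multiple of [e] against [p], so the difference quotient of the convex
   function [S] at [p] drops by a fixed amount each time [e] is halved, whereas
   it is bounded below by that of [h]. *)
Lemma Zset_payoff_le p x i : Zset delta lambda u M p -> zstar u p x -> u i x <= h u p.
Proof.
have /andP[l0 l1] := l01; have /andP[d0 d1] := d01.
move=> /Zset_gap/subr0_eq Fp zx; rewrite leNgt; apply/negP => mc.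
have [al alE] := toward_vertex p i.
have al_cvg : al @ 0^'+ --> p.
  apply: cvg_worldview => j; apply/cvgrPdist_lt => e e0.
  near=> s.
  have s0 : 0 < s by near: s; exact: nbhs_right_gt.
  have s1' : s < 1 by near: s; exact: nbhs_right_lt.
  have se : s < e by near: s; exact: nbhs_right_lt.
  rewrite alE ?(ltW s0) ?(ltW s1')//.
  rewrite (_ : _ - _ = s * (weight p j - (i == j)%:R)); last by ring.
  rewrite normrM gtr0_norm// (le_lt_trans _ se)// ler_piMr// ?(ltW s0)//.
  rewrite ler_norml; have := weight_ge0 p j; have := weight_le1 p j.
  by case: (i == j) => /=; lra.
have /al_cvg := zstar_near u p.
rewrite /fmap/= => /nbhs_ballP[e1 /= e1_gt0 he1].
(* Below [e0] the formula for [al e] applies and [al e] plays only actions optimal at [p]. *)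
pose e0 := Num.min e1 1.
have e0_gt0 : 0 < e0 by rewrite lt_min e1_gt0/=.
have zal e : 0 < e < e0 -> zstar u (al e) `<=` zstar u p.
  move=> /andP[e_gt0]; rewrite lt_min => /andP[ee1 _]; apply: he1 => //.
  by rewrite /ball /= sub0r normrN gtr0_norm.
have al01 e : 0 < e < e0 -> 0 <= e <= 1.
  by move=> /andP[e_gt0]; rewrite lt_min => /andP[_ /ltW ->]; rewrite ltW.
have Ual e y : 0 < e < e0 -> U u (al e) y = (1 - e) * U u p y + e * u i y.
  move=> /al01/alE ae; rewrite /U; under eq_bigr do rewrite ae mulrDl -!mulrA.
  rewrite big_split/= -!mulr_sumr; congr (_ + _ * _).
  rewrite (bigD1 i)//= eqxx mul1r big1 ?addr0// => j ji.
  by rewrite eq_sym (negbTE ji) mul0r.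
pose m := u i x; pose c := h u p.
have hal e : 0 < e < e0 -> c + e * (m - c) <= h u (al e).
  move=> he; apply: le_trans (U_le_h u _ x); rewrite Ual// -(h_zstar zx) -/c -/m.
  lra.
(* [hal] gives [al e] an excess of (1 - lambda) e (m - c) in the first period; C(al e; p) <= S(p)
   then forces the discounted continuation to lose as much, hence the division by [delta]. *)
pose k := (1 - lambda) * (m - c) / delta.
have k_gt0 : 0 < k by rewrite divr_gt0// mulr_gt0// subr_gt0.
pose Q e := S (al e) - S p.
have Q_ge0 e : 0 < e < e0 -> 0 <= Q e.
  move=> he; have e_gt0 : 0 < e by case/andP: he.
  have := hal e he; have := h_le_S (al e); rewrite /Q -/c in Fp *.
  have : 0 < e * (m - c) by rewrite mulr_gt0// subr_gt0.
  nra.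
(* [al e] is the midpoint of [p] and [al (2 * e)], and [TC (al e)] is affine in the judge: its loss
   at [p] becomes a gain at [al (2 * e)], where S dominates it. *)
have Q_double e : 0 < e < e0 -> 0 < 2 * e < e0 -> 2 * Q e + k * e <= Q (2 * e).
  move=> he he2.
  have Kp : K (al e) p <= S p - k * e.
    have := Cle (al e) p; rewrite Crec.
    have -> : UB p (al e) = c.
      by apply/eqP; rewrite eq_le UB_le_h; apply: UB_ge => y /(zal _ he) /h_zstar <-.
    have h1 := hal e he.
    have h2 : (1 - lambda) * (c + e * (m - c)) <= (1 - lambda) * h u (al e).
      by rewrite ler_wpM2l// subr_ge0 ltW.
    have h3 : delta * (k * e) = (1 - lambda) * e * (m - c).
      by rewrite /k; field; rewrite gt_eqF.
    move=> h4; rewrite -(ler_pM2l d0) mulrBr h3.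
    rewrite -/c in Fp; lra.
  have := Kle (al e) (al (2 * e)).
  have -> : K (al e) (al (2 * e)) = 2 * S (al e) - K (al e) p.
    rewrite /S !(TC_sum _ _ _ d01).
    have -> : \sum_j weight (al (2 * e)) j * Kop Pi (Wval delta u Pi j) (al e) =
        2 * (\sum_j weight (al e) j * Kop Pi (Wval delta u Pi j) (al e)) -
        \sum_j weight p j * Kop Pi (Wval delta u Pi j) (al e).
      rewrite mulr_sumr -sumrB; apply: eq_bigr => j _.
      rewrite !alE ?al01//; ring.
    ring.
  rewrite /Q; lra.
pose e2 := e0 / 2.
have he2 N : 0 < e2 / 2 ^+ N < e0.
  rewrite divr_gt0 ?divr_gt0 ?exprn_gt0//= ltr_pdivrMr ?exprn_gt0//.
  apply: (@lt_le_trans _ _ e0); first by rewrite /e2; lra.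
  by rewrite ler_peMr ?(ltW e0_gt0)// exprn_ege1// ler1n.
(* The N-th halving contributes [2 ^+ N * k * (e2 / 2 ^+ N.+1)], which is the same amount for every
   N. *)
have Qbound N : 2 ^+ N * Q (e2 / 2 ^+ N) + N%:R * (k * e2 / 2) <= Q e2.
  elim: N => [|N ih]; first by rewrite expr0 mul1r divr1 mul0r addr0.
  apply: le_trans ih.
  have e2E : 2 * (e2 / 2 ^+ N.+1) = e2 / 2 ^+ N.
    by rewrite exprS; field; rewrite expf_eq0 pnatr_eq0 andbF.
  have := Q_double _ (he2 N.+1); rewrite e2E => /(_ (he2 N)) h1.
  have p0 : 0 < 2 ^+ N :> R by rewrite exprn_gt0.
  have := ler_wpM2l (ltW p0) h1.
  have -> : 2 ^+ N * (2 * Q (e2 / 2 ^+ N.+1) + k * (e2 / 2 ^+ N.+1)) =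
      2 ^+ N.+1 * Q (e2 / 2 ^+ N.+1) + k * e2 / 2.
    by rewrite exprS; field; rewrite expf_eq0 pnatr_eq0 andbF.
  rewrite -addn1 natrD; lra.
have ke2 : 0 < k * e2 / 2 by rewrite divr_gt0// mulr_gt0// divr_gt0.
have [N hN] : exists N, Q e2 < N%:R * (k * e2 / 2).
  exists (Num.truncn (Q e2 / (k * e2 / 2))).+1.
  rewrite -ltr_pdivrMr//; exact: truncnS_gt.
have := Qbound N; rewrite leNgt => /negP; apply.
rewrite (lt_le_trans hN)// lerDr mulr_ge0 ?exprn_ge0//.
exact: Q_ge0.
Unshelve. all: by end_near. Qed.

(** As u_i(x) <= h(p) for all i, M(x) <= h(p); but U(p, x) falls short of M(x) by a weighted sum of
    nonnegative terms. This sum vanishes, and with it every term of positive weight. *)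
Lemma Zset_payoff p x : Zset delta lambda u M p -> zstar u p x ->
  [/\ U u p x = h u p, h u p = Mx u x & forall i, 0 < weight p i -> u i x = Mx u x].
Proof.
move=> Zp zx; have up i := Zset_payoff_le i Zp zx.
have uM j : u j x <= Mx u x by rewrite /Mx; apply: le_bigmax.
have Up := h_zstar zx.
have UM : U u p x = Mx u x - \sum_j weight p j * (Mx u x - u j x).
  under eq_bigr do rewrite mulrBr.
  by rewrite sumrB -mulr_suml sum_weight mul1r opprB addrC subrK.
have w0 j : 0 <= weight p j * (Mx u x - u j x) by rewrite mulr_ge0 ?weight_ge0// subr_ge0.
have hM : h u p = Mx u x.
  apply/eqP; rewrite eq_le; apply/andP; split.
    by rewrite Up UM gerBl; exact: sumr_ge0.
  by rewrite /Mx; apply: bigmax_le => [|j _]; exact: up.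
split=> // i wi.
have : \sum_j weight p j * (Mx u x - u j x) == 0.
  by apply/eqP; move: UM; rewrite -Up hM; lra.
rewrite psumr_eq0 => [/allP/(_ i (mem_index_enum _))|j _]; last exact: w0.
by rewrite mulf_eq0 gt_eqF//= subr_eq0 => /eqP.
Qed.

(** * Unique maximizers: convergence to a vertex *)

Section UniqueArgmax.
Hypothesis uniq : forall x, XI u x -> unique_argmax u x.

Lemma Mx_argmax_inj x i j : XI u x -> u i x = Mx u x -> u j x = Mx u x -> i = j.
Proof.
have uM k : u k x <= Mx u x by rewrite /Mx; apply: le_bigmax.
move=> /uniq; rewrite /unique_argmax => /mem_card1[k hk] ui uj.
have mem l : u l x = Mx u x -> l = k.
  move=> ul; apply/eqP; have := hk l; rewrite !inE => <-.
  by apply/forallP => m; rewrite ul.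
by rewrite (mem i)// (mem j).
Qed.

(** All indices of positive weight maximize u_i(x) for one and the same optimal x, so uniqueness
    leaves a single one. *)
Lemma Zset_vertex p : Zset delta lambda u M p -> exists j, p = vertex R j.
Proof.
move=> Zp; have [x zx] := zstar_nonempty u p.
have [_ _ hx] := Zset_payoff Zp zx.
have Xx : XI u x by exists p.
have [j /hx jM] : exists j, 0 < weight p j.
  apply: contrapT => /forallNP h.
  have : \sum_j weight p j = 0.
    by rewrite big1// => j _; apply/eqP; rewrite eq_le weight_ge0 andbT leNgt; exact/negP.
  by move/eqP; rewrite sum_weight oner_eq0.
exists j; apply: weight_eq1; rewrite -(sum_weight p) (bigD1 j)//= big1 ?addr0// => i ij.
apply/eqP; rewrite eq_le weight_ge0 andbT leNgt; apply: contra ij => /hx iM.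
exact/eqP/(Mx_argmax_inj Xx).
Qed.

Section Path.
Variable a : nat -> T.
Hypothesis aC : forall t, C (a t.+1) (a t) = S (a t).

(** S has one limit along the path, so S(p) = S(q), and the limit of [step_le] yields an x optimal
    at [q] with h(q) <= U(p, x). Since h(q) = M(x), both vertices maximize u_i(x), hence
    coincide. *)
Lemma cluster_pair p q : cluster ((fun t => (a t, a t.+1)) @ \oo) (p, q) ->
  [/\ Zset delta lambda u M p, Zset delta lambda u M q & p = q].
Proof.
have /andP[l0 l1] := l01.
pose b t := (a t, a t.+1); move=> cb.
have cfst (f : T -> R) : continuous f -> continuous (fun y : T * T => f y.1).
  by move=> cf y; apply: (@continuous_comp _ _ _ fst f); [exact: cvg_fst|exact: cf].
have csnd (f : T -> R) : continuous f -> continuous (fun y : T * T => f y.2).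
  by move=> cf y; apply: (@continuous_comp _ _ _ snd f); [exact: cvg_snd|exact: cf].
have gap0 := gap_path_cvg0 aC.
have gap0' : G (a t.+1) @[t --> \oo] --> 0 by rewrite (cvg_shiftS (fun t => G (a t))).
have cvS := S_path_cvg aC.
have cvS' : S (a t.+1) @[t --> \oo] --> limn (fun t => S (a t)).
  by rewrite (cvg_shiftS (fun t => S (a t))).
have Zp : Zset delta lambda u M p.
  exact/Zset_gap/(cluster_cvg_eq (b := b) (cfst _ G_continuous) gap0 cb).
have Zq : Zset delta lambda u M q.
  exact/Zset_gap/(cluster_cvg_eq (b := b) (csnd _ G_continuous) gap0' cb).
split=> //.
have Spq : S p = S q.
  rewrite (cluster_cvg_eq (b := b) (cfst _ S_continuous) cvS cb).
  by rewrite (cluster_cvg_eq (b := b) (csnd _ S_continuous) cvS' cb).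
have /Zset_gap/subr0_eq Fp := Zp; have /Zset_gap/subr0_eq Fq := Zq.
(* [UB] may be discontinuous in the acting state, so the limit is taken by contradiction: if every
   action optimal at [q] failed strictly, finitely many strict inequalities would persist near (p,
   q), where only these actions are played. *)
have [x zx hx] : exists2 x, zstar u q x & h u q <= U u p x.
  apply: contrapT => nx.
  have hx x : zstar u q x -> U u p x < h u q.
    by move=> zx; rewrite ltNge; apply/negP => hx; apply: nx; exists x.
  pose D x (y : T * T) := (1 - delta) * S y.1 - (1 - lambda) * h u y.2 - lambda * U u y.1 x.
  have cD x : continuous (D x).
    move=> y; apply: cvgB; first apply: cvgB.
    - exact: (cfst _ F_continuous).
    - by apply: cvgM; [exact: cvg_cst|exact: (csnd _ (@h_continuous R n X u))].
    - by apply: cvgM; [exact: cvg_cst|exact: (cfst _ (@U_continuous R n X u x))].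
  have nearD : \forall y \near (p, q), forall x, zstar u q x -> 0 < D x y.
    apply: (@filter_forall _ _ (fun x y => zstar u q x -> 0 < D x y) (nbhs (p, q))) => x.
    have [zx|nzx] := pselect (zstar u q x); last exact: nearW.
    have D0 : 0 < D x (p, q).
      rewrite /D /= Spq Fq; have := hx _ zx; rewrite -(ltr_pM2l l0); lra.
    have /cvgrPdist_lt/(_ _ D0) := cD x (p, q).
    by apply: filterS => y; rewrite ltr_norml => /andP[_ h1] _; move: h1; lra.
  have nearz : \forall y \near (p, q), zstar u y.2 `<=` zstar u q.
    exists (setT, [set c | zstar u c `<=` zstar u q]) => [|[c c'] [_ h]]; last exact: h.
    by split => /=; [exact: filterT|exact: zstar_near].
  (* Meeting the range makes the nearby point an actual transition of the path, to which [step_le]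
     applies. *)
  have bT : (b @ \oo) (range b) by exists 0%N => // t _; exists t.
  have [y [[t _ <-] /= [h1 h2]]] := cb (range b) _ bT (filterI nearD nearz).
  have := step_le (aC t).
  have : UB (a t) (a t.+1) < ((1 - delta) * S (a t) - (1 - lambda) * h u (a t.+1)) / lambda.
    apply: UB_lt => x /h2 /h1; rewrite /D /= ltr_pdivlMr// => h3; lra.
  rewrite ltr_pdivlMr//; lra.
have [_ hqx hwx] := Zset_payoff Zq zx.
have [i pi] := Zset_vertex Zp; have [k qk] := Zset_vertex Zq.
have Uv j y : U u (vertex R j) y = u j y.
  rewrite /U (bigD1 j)//= weight_vertex eqxx mul1r big1 ?addr0// => l lj.
  by rewrite weight_vertex eq_sym (negbTE lj) mul0r.
have Xx : XI u x by exists q.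
rewrite pi qk; congr (vertex R _); apply: (Mx_argmax_inj Xx).
  apply/eqP; rewrite eq_le -{2}hqx -[in X in _ && (_ <= X)]Uv -pi hx andbT.
  by rewrite /Mx; apply: le_bigmax.
by apply: hwx; rewrite qk weight_vertex eqxx.
Qed.

Lemma path_cvg_vertex : exists2 j, Zset delta lambda u M (vertex R j) & a @ \oo --> vertex R j.
Proof.
(* A weight above 1/2 determines its index, and in [O] one index has such a weight at two
   consecutive dates; the index is therefore constant once the pairs stay in [O]. *)
pose O : set (T * T) := [set y | exists j, [/\ Zset delta lambda u M (vertex R j),
  1 / 2 < weight y.1 j & 1 / 2 < weight y.2 j]].
have cTT : compact [set: T * T].
  by rewrite -setXTT; apply: compact_setX; exact: worldview_compact.
have nearO : \forall t \near \oo, O (a t, a t.+1).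
  apply: (compact_cluster_near cTT) => -[p q] /cluster_pair[Zp _ <-].
  have [j pj] := Zset_vertex Zp.
  have h1 : \forall c \near p, 1 / 2 < weight c j.
    have h2 : 0 < 1 / 2 :> R by rewrite divr_gt0.
    have /cvgrPdist_lt/(_ _ h2) := @weight_continuous R n j p.
    apply: filterS => c; rewrite pj weight_vertex eqxx mulr1n ltr_norml => /andP[_ hc]; lra.
  exists ([set c | 1 / 2 < weight c j], [set c | 1 / 2 < weight c j]) => //.
  by move=> [c c'] /= [hc hc']; exists j; split => //; rewrite -pj.
have [N _ hN] := nearO.
have wuniq (c : T) i j : 1 / 2 < weight c i -> 1 / 2 < weight c j -> i = j.
  move=> ci cj; apply/eqP/negPn/negP => ij.
  have := sum_weight c; rewrite (bigD1 i)//= (bigD1 j) 1?eq_sym//=.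
  have : 0 <= \sum_(k | (k != i) && (k != j)) weight c k.
    by apply: sumr_ge0 => k _; exact: weight_ge0.
  lra.
have [j [Zj aj _]] := hN N (leqnn _).
exists j => //.
have wj t : (N <= t)%N -> 1 / 2 < weight (a t) j.
  elim: t => [|t ih]; first by rewrite leqn0 => /eqP N0; rewrite N0 in aj.
  rewrite leq_eqVlt => /predU1P[<-//|/[!ltnS] Nt].
  have [k [_ hk hk']] := hN t Nt.
  by rewrite (wuniq _ _ _ (ih Nt) hk).
(* A cluster point is a vertex, and it is not a vertex [k] other than [j], where the j-th weight is
   0; compactness turns this into convergence. *)
move=> A vA; apply: (compact_cluster_near worldview_compact) => p cp.
have [k pk] := Zset_vertex (cluster_path_Zset aC cp).
suff kj : k = j by rewrite pk kj.
apply: contrapT => kj.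
have h2 : 0 < 1 / 2 :> R by rewrite divr_gt0.
have /cvgrPdist_lt/(_ _ h2) := @weight_continuous R n j p => pw.
have aw : \forall t \near \oo, [set c | 1 / 2 < weight c j] (a t).
  by exists N => // t /wj.
have [c [/= cw]] := cp _ _ aw pw.
rewrite pk weight_vertex (negbTE (introN eqP kj)) mulr0n sub0r normrN gtr0_norm; lra.
Qed.

End Path.

Let U_vertex j y : U u (vertex R j) y = u j y.
Proof.
rewrite /U (bigD1 j)//= weight_vertex eqxx mul1r big1 ?addr0// => l lj.
by rewrite weight_vertex eq_sym (negbTE lj) mul0r.
Qed.

Lemma U_le_Mx (c : T) x : U u c x <= Mx u x.
Proof.
rewrite -[leRHS]mul1r -(sum_weight c) mulr_suml; apply: ler_sum => j _.
by rewrite ler_wpM2l ?weight_ge0// /Mx; apply: le_bigmax.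
Qed.

Lemma U_eq_Mx (c : T) x j : XI u x -> u j x = Mx u x -> Mx u x <= U u c x -> c = vertex R j.
Proof.
move=> Xx jM MU; have uM k : u k x <= Mx u x by rewrite /Mx; apply: le_bigmax.
have w0 k : 0 <= weight c k * (Mx u x - u k x) by rewrite mulr_ge0 ?weight_ge0// subr_ge0.
have : \sum_k weight c k * (Mx u x - u k x) == 0.
  rewrite eq_le sumr_ge0// andbT.
  under eq_bigr do rewrite mulrBr.
  by rewrite sumrB -mulr_suml sum_weight mul1r subr_le0.
rewrite psumr_eq0 => [/allP h0|k _]; last exact: w0.
apply: weight_eq1; rewrite -(sum_weight c) (bigD1 j)//= big1 ?addr0// => i ij.
have := h0 i (mem_index_enum _); rewrite mulf_eq0 => /orP[/eqP//|].
by rewrite subr_eq0 => /eqP Mi; rewrite (Mx_argmax_inj Xx (esym Mi) jM) eqxx in ij.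
Qed.

(** * Absorption above the threshold *)

Section Threshold.
Variable xs : 'I_n.+1 -> X.
Hypothesis hxs : forall j, zstar u (vertex R j) = [set xs j].
Hypothesis lambda_gt : lambda_hat u xs < lambda.

Let zxs j : zstar u (vertex R j) (xs j). Proof. by rewrite hxs. Qed.

Let h_vertex j : h u (vertex R j) = u j (xs j).
Proof. by rewrite (h_zstar (zxs j)) U_vertex. Qed.

Let XIxs j : XI u (xs j). Proof. by exists (vertex R j). Qed.

Lemma lambda_hat_ge j y : u j (xs j) = Mx u (xs j) -> y != xs j -> 0 < Rgap u j y ->
  1 - Dgap u xs j y / Rgap u j y <= lambda_hat u xs.
Proof.
move=> jM yx R0; rewrite /lambda_hat.
pose f j y := 1 - Dgap u xs j y / Rgap u j y.
apply: (@le_trans _ _ (\big[Num.max/0]_(y | (y != xs j) && (0 < Rgap u j y)) f j y)).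
  by apply: (le_bigmax_cond 0 (f j)); rewrite yx.
apply: (le_bigmax_cond 0
  (fun j => \big[Num.max/0]_(y | (y != xs j) && (0 < Rgap u j y)) f j y)).
by rewrite /Jdagger inE jM.
Qed.

(** For y = x_j, uniqueness makes h(c) = U(c, x_j) strictly less than M(x_j) = h_j. Otherwise h(c)
    <= M(y), and 1 - D/R is exactly the lambda at which (1 - lambda) M(y) + lambda u_j(y) equals
    h_j; if R = 0, D > 0 is enough. *)
Lemma one_step_lt j c y : Zset delta lambda u M (vertex R j) -> c <> vertex R j ->
  zstar u c y -> (1 - lambda) * h u c + lambda * u j y < u j (xs j).
Proof.
have /andP[l0 l1] := l01; have l1' : 0 < 1 - lambda by rewrite subr_gt0.
move=> Zj cj zy; have [_ hM _] := Zset_payoff Zj (zxs j).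
rewrite h_vertex in hM.
have [yx|yx] := eqVneq y (xs j).
  rewrite yx in zy *; have : h u c < u j (xs j).
    rewrite hM (h_zstar zy) ltNge; apply/negP => /U_eq_Mx h1; apply: cj.
    exact: h1.
  by rewrite -(ltr_pM2l l1'); lra.
have jy : u j y < u j (xs j).
  rewrite ltNge; apply/negP => h1.
  have : zstar u (vertex R j) y.
    by apply: zstar_h; apply/eqP; rewrite eq_le U_le_h h_vertex U_vertex.
  by rewrite hxs => /eqP; rewrite (negbTE yx).
have hy : (1 - lambda) * h u c <= (1 - lambda) * Mx u y.
  by rewrite ler_pM2l// (h_zstar zy); exact: U_le_Mx.
have [R0|R0] := ltP 0 (Rgap u j y); last by move: R0 hy jy; rewrite /Rgap; nra.
have := le_lt_trans (lambda_hat_ge hM yx R0) lambda_gt.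
rewrite ltrBlDr -ltrBlDl ltr_pdivlMr// /Dgap /Rgap; lra.
Qed.

(** Any other [c] yields less than h_j in its first period and at most S afterwards, while h_j +
    delta S <= S. *)
Lemma Zset_vertex_absorbing j : Zset delta lambda u M (vertex R j) ->
  absorbing Pi (vertex R j).
Proof.
have /andP[l0 l1] := l01; have /andP[d0 d1] := d01.
move=> Zj; apply: (absorbing_of_strict d01 s1 E) => c cj; rewrite Crec.
have hS := h_le_S (vertex R j); rewrite h_vertex in hS.
have : UB (vertex R j) c < (u j (xs j) - (1 - lambda) * h u c) / lambda.
  apply: UB_lt => y zy; rewrite ltr_pdivlMr// U_vertex.
  by have := one_step_lt Zj cj zy; lra.
rewrite ltr_pdivlMr// => h1.
by have := ler_wpM2l (ltW d0) (Kle c (vertex R j)); lra.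
Qed.

(** Let a_(N+1) be so close to vertex j that it plays only x_j. For a_N, starting from the absorbing
    vertex is worth (1 - lambda) h_j + lambda U(a_N, x_j) per period, and [step_le] bounds its value
    by the same expression with h(a_(N+1)) for h_j. So U(a_(N+1), x_j) >= h_j = M(x_j), which only
    the vertex achieves. *)
Lemma path_absorbed (a : nat -> T) : (forall t, C (a t.+1) (a t) = S (a t)) ->
  exists t j, a t = vertex R j /\ absorbing Pi (vertex R j).
Proof.
have /andP[l0 l1] := l01; have /andP[d0 d1] := d01.
move=> aC; have [j Zj aj] := path_cvg_vertex aC.
have absj := Zset_vertex_absorbing Zj.
have [N _ hN] := aj _ (zstar_near u (vertex R j)).
exists N.+1, j; split => //.
have zN : zstar u (a N.+1) `<=` [set xs j] by rewrite -hxs; exact: hN (leqnSn N).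
have [y zy] := zstar_nonempty u (a N.+1); have yx := zN _ zy; rewrite yx in zy.
have [_ hM _] := Zset_payoff Zj (zxs j); rewrite h_vertex in hM.
apply: (U_eq_Mx (XIxs j) hM); rewrite -hM -(h_zstar zy) -(@ler_pM2l _ (1 - lambda)) ?subr_gt0//.
have UB1 : UB (a N) (a N.+1) <= U u (a N) (xs j) by apply: UB_le => x /zN ->.
have UB2 : U u (a N) (xs j) <= UB (a N) (vertex R j).
  by apply: UB_ge => x; rewrite hxs => ->.
have h1 := step_le (aC N).
have h2 := Cle (vertex R j) (a N).
have h3 := Crec (vertex R j) (a N).
rewrite (absorbing_TC lambda u d01 (a N) absj) h_vertex in h3.
have {}UB1 := ler_wpM2l (ltW l0) UB1; have {}UB2 := ler_wpM2l (ltW l0) UB2.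
have := @ler_wpM2l _ (1 - delta) _ _ _ h2; rewrite subr_ge0 => /(_ (ltW d1)).
lra.
Qed.

End Threshold.
End UniqueArgmax.

End Dynamics.

(** * Convergence events and payoff perturbations *)

Lemma cvg_ptws {S I : Type} {V : topologicalType} (F : set_system S) {FF : Filter F}
    (f : S -> I -> V) (g : I -> V) :
  (forall i, f s i @[s --> F] --> g i) ->
  ((f : S -> {ptws I -> V}) s @[s --> F]) --> (g : {ptws I -> V}).
Proof.
move=> fg; apply/cvg_sup => i A.
rewrite nbhsE => -[B [oB Bg] BA]; case: oB => O oO OB.
have gO : nbhs (g i) O by apply: open_nbhs_nbhs; split => //; rewrite -OB in Bg.
apply: (@filterS _ F _ _ _ _ (fg i _ gO)) => s Os.
by apply: BA; rewrite -OB.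
Qed.

Section Convergence.
Context {R : realType} {n : nat} {X : finPointedType}.
Variables (Pi : strategy R n X) (M : realization Pi).

(** The other weights are at most 1 minus the j-th, so one real sequence decides convergence; this
    is what makes the event measurable. *)
Lemma converges_to_weight (w : Omega M) j : converges_to w j <->
  weight (view M t w) j @[t --> \oo] --> (1 : R).
Proof.
split=> [cw|cw].
  have := cvg_comp _ _ (cw : (fun t => view M t w) @ \oo --> vertex R j) (@weight_continuous R n j (vertex R j)).
  by rewrite weight_vertex eqxx mulr1n.
apply: cvg_worldview => i; rewrite weight_vertex.
have [<-|ij] := eqVneq j i; first exact: cw.
apply: (@squeeze_cvgr _ _ _ _ (fun=> 0) (fun t => 1 - weight (view M t w) j)).
- apply: nearW => t; rewrite weight_ge0 /= lerBrDr -(sum_weight (view M t w)).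
  rewrite (bigD1 i)//= (bigD1 j)//= addrA lerDl.
  by apply: sumr_ge0 => k _; exact: weight_ge0.
- exact: cvg_cst.
- rewrite -[X in _ --> X](subrr (1 : R)).
  by apply: cvgB => //; exact: cvg_cst.
Qed.

Lemma converges_to_inj (w : Omega M) i j : converges_to w i -> converges_to w j -> i = j.
Proof.
move=> wi /converges_to_weight wj.
have := cvg_comp _ _ (wi : (fun t => view M t w) @ \oo --> vertex R i) (@weight_continuous R n j (vertex R i)).
rewrite weight_vertex => wi'; apply/eqP/negPn/negP => ij.
have : 1 = (i == j)%:R :> R by exact: (cvg_unique (@norm_hausdorff _ _) wj wi').
by rewrite (negbTE ij) => /eqP; rewrite oner_eq0.
Qed.

Lemma measurable_converges_to j : measurable [set w : Omega M | converges_to w j].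
Proof.
(* Weights never exceed 1, so convergence to 1 amounts to countably many eventual lower bounds. *)
rewrite (_ : [set w | _] = \bigcap_m \bigcup_N \bigcap_(t in [set t | (N <= t)%N])
    [set w : Omega M | 1 - m.+1%:R^-1 < weight (view M t w) j]).
  apply: bigcapT_measurable => m; apply: bigcupT_measurable => N.
  apply: bigcap_measurable => [|t _]; first by exists N => /=.
  have [mw _] := @weight_bounded_measurable R n j.
  have mwv : measurable_fun setT (fun w : Omega M => weight (view M t w) j).
    exact: measurableT_comp mw _.
  rewrite -[X in measurable X]setTI.
  rewrite (_ : [set w | _] = (fun w : Omega M => weight (view M t w) j) @^-1`
      `]1 - m.+1%:R^-1, +oo[%classic).
    exact: mwv.
  by apply/seteqP; split => w /=; rewrite in_itv/= andbT.
apply/seteqP; split => w /=.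
  move=> /converges_to_weight cw m _.
  have m0 : 0 < m.+1%:R^-1 :> R by rewrite invr_gt0.
  have /cvgrPdist_lt/(_ _ m0)[N _ hN] := cw.
  exists N => // t Nt /=; have := hN t Nt; rewrite /= ltr_norml => /andP[_].
  by rewrite ltrBlDr addrC -ltrBlDr.
move=> cw; apply/converges_to_weight/cvgrPdist_lt => e e0.
have [N _ hN] := cw (Num.truncn e^-1) I.
exists N => // t /hN /= h1; rewrite ger0_norm ?subr_ge0 ?weight_le1//.
apply: (@lt_trans _ _ ((Num.truncn e^-1).+1%:R^-1)); first by rewrite ltrBlDr addrC -ltrBlDr.
by rewrite -[ltRHS]invrK ltf_pV2 ?posrE ?invr_gt0// truncnS_gt.
Qed.

Lemma limit_index_measurable : exists Jinf : Omega M -> 'I_n.+1,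
  (forall j, measurable (Jinf @^-1` [set j])) /\
  forall w j, converges_to w j -> converges_to w (Jinf w).
Proof.
(* Paths without a limit receive [ord0], so the preimage of [ord0] is treated apart below. *)
pose Jinf (w : Omega M) := if [pick j | `[< converges_to w j >]] is Some j then j else ord0.
have JP w j : converges_to w j -> Jinf w = j.
  rewrite /Jinf => wj; case: pickP => [i /asboolP wi|/(_ j)]; last by rewrite asboolT.
  exact: converges_to_inj wi wj.
have J0 w : ~ (exists j, converges_to w j) -> Jinf w = ord0.
  rewrite /Jinf => nw; case: pickP => // i /asboolP wi.
  by exfalso; apply: nw; exists i.
exists Jinf; split=> [j|w j wj]; last by rewrite (JP _ _ wj).
pose A : set (Omega M) := \bigcup_(k in [set: 'I_n.+1]) [set w | converges_to w k].
have mA : measurable A.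
  by apply: fin_bigcup_measurable => // k _; exact: measurable_converges_to.
have [->|j0] := eqVneq j ord0.
  rewrite (_ : _ @^-1` _ = [set w | converges_to w ord0] `|` ~` A).
    by apply: measurableU; [exact: measurable_converges_to|exact: measurableC].
  apply/seteqP; split => w /=.
    move=> Jw; have [[k wk]|nw] := pselect (exists k, converges_to w k).
      by left; rewrite -Jw (JP _ _ wk).
    by right => -[k _ wk]; apply: nw; exists k.
  by move=> [/JP//|nA]; apply: J0 => -[k wk]; apply: nA; exists k.
rewrite (_ : _ @^-1` _ = [set w | converges_to w j]); first exact: measurable_converges_to.
apply/seteqP; split => w /=; last exact: JP.
move=> Jw; have [[k wk]|nw] := pselect (exists k, converges_to w k).
  by rewrite -Jw (JP _ _ wk).
by move: j0; rewrite -Jw (J0 _ nw) eqxx.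
Qed.

End Convergence.

(** * Failure of convergence requires payoff ties *)

Section Payoffs.
Context {R : realType} {n : nat} {X : finPointedType}.
Variables (delta lambda : R).
Hypotheses (d01 : 0 < delta < 1) (l01 : 0 < lambda < 1).
Local Notation payoff := ('I_n.+1 -> X -> R).

Lemma injective_unique_argmax (u : payoff) x :
  injective (u ^~ x) -> unique_argmax u x.
Proof.
move=> ui; pose j := [arg max_(j > ord0) u j x]%O.
have hj i : u i x <= u j x by rewrite /j; case: arg_maxP => // k _; exact.
rewrite /unique_argmax; rewrite -(card1 j); apply: eq_card => k; rewrite !inE.
apply/forallP/eqP => [hk|-> //]; apply: ui.
by apply/eqP; rewrite eq_le hj hk.
Qed.

Lemma ae_converges_to (u : payoff) (Pi : strategy R n X) (M : realization Pi) b :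
  is_MPE delta lambda u M -> (forall x, XI u x -> unique_argmax u x) ->
  {ae Pr M b, forall w, exists j, converges_to w j}.
Proof.
move=> E uniq.
have [N [mN N0 sN]] := ae_view_optimal d01 (fun a => (E a).1) E b.
exists N; split => // w /= hw; apply: sN => /= /(path_cvg_vertex d01 l01 E uniq)[j _ cj].
by apply: hw; exists j.
Qed.

Lemma bad_payoffs_tie : bad_payoffs R n X delta lambda `<=`
  \bigcup_(x in [set: X]) \bigcup_(ij in [set ij : 'I_n.+1 * 'I_n.+1 | (ij.1 < ij.2)%N])
    [set u | u ij.1 x = u ij.2 x].
Proof.
move=> u [Pi [M [E [b Pb]]]]; apply: contrapT => nu.
have ui x : injective (u ^~ x).
  move=> i j uij; apply/eqP/negPn/negP => ij; apply: nu; exists x => //.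
  have [lij|lji|/val_inj eij] := ltngtP i j.
  - by exists (i, j).
  - by exists (j, i).
  - by rewrite eij eqxx in ij.
have [N [mN N0 sN]] := ae_converges_to b E (fun x _ => injective_unique_argmax (ui x)).
(* The bad event is the complement of the measurable [A], so inclusion in a null set gives it
   probability 0. *)
pose A : set (Omega M) := \bigcup_(k in [set: 'I_n.+1]) [set w | converges_to w k].
have mA : measurable A.
  by apply: fin_bigcup_measurable => // k _; exact: measurable_converges_to.
suff e : [set w : Omega M | ~ exists j, converges_to w j] = ~` A.
  have sN' : ~` A `<=` N by rewrite -e.
  have P0 := subset_measure0 (measurableC mA) mN sN' N0.
  by rewrite e P0 ltxx in Pb.
by apply/seteqP; split => w /= nw; [move=> [j _ wj]|move=> [j wj]]; apply: nw; exists j.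
Qed.

Lemma interior_ties (B : set payoff) : B `<=`
    \bigcup_(x in [set: X]) \bigcup_(ij in [set ij : 'I_n.+1 * 'I_n.+1 | (ij.1 < ij.2)%N])
      [set u | u ij.1 x = u ij.2 x] ->
  interior (B : set {ptws 'I_n.+1 -> {ptws X -> R}}) = set0.
Proof.
move=> Bt; rewrite -subset0 => u Bu.
(* Adding [i * e] to row [i] breaks all ties at once: tied entries separate for every e > 0, and
   distinct ones stay apart while e is below their distance divided by j - i. *)
pose v (e : R) : payoff := fun i x => u i x + (i : nat)%:R * e.
have cv : (v : R -> {ptws 'I_n.+1 -> {ptws X -> R}}) e @[e --> 0^'+] -->
    (u : {ptws 'I_n.+1 -> {ptws X -> R}}).
  apply: cvg_ptws => i; apply: cvg_ptws => x.
  rewrite /v -[X in _ --> X]addr0 -[X in _ --> _ + X](mulr0 (i : nat)%:R).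
  apply: cvgD; first exact: cvg_cst.
  apply: cvgM; first exact: cvg_cst.
  exact: cvg_at_right_filter.
have nearB : \forall e \near 0^'+, B (v e) := cv _ Bu.
have near_ne : \forall e \near (0 : R)^'+, forall t : X * ('I_n.+1 * 'I_n.+1),
    (t.2.1 < t.2.2)%N -> v e t.2.1 t.1 <> v e t.2.2 t.1.
  apply: (@filter_forall _ _ (fun (t : X * ('I_n.+1 * 'I_n.+1)) e =>
    (t.2.1 < t.2.2)%N -> v e t.2.1 t.1 <> v e t.2.2 t.1) (0 : R)^'+) => -[x [i j]] /=.
  have [ij|_] := ltnP i j; last exact: nearW.
  have ij0 : 0 < (j : nat)%:R - (i : nat)%:R :> R by rewrite subr_gt0 ltr_nat.
  have [ue|une] := eqVneq (u i x) (u j x).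
    near=> e => _; rewrite /v ue => /addrI /eqP.
    have e0 : e != 0 by rewrite gt_eqF//; near: e; exact: nbhs_right_gt.
    by rewrite (inj_eq (mulIf e0)) eqr_nat ltn_eqF.
  have d0 : 0 < `|u i x - u j x| / ((j : nat)%:R - (i : nat)%:R).
    by rewrite divr_gt0// normr_gt0 subr_eq0.
  near=> e => _ h1.
  have e0 : 0 < e by near: e; exact: nbhs_right_gt.
  have : e < `|u i x - u j x| / ((j : nat)%:R - (i : nat)%:R).
    by near: e; exact: nbhs_right_lt.
  have -> : u i x - u j x = ((j : nat)%:R - (i : nat)%:R) * e.
    by move: h1; rewrite /v; lra.
  by rewrite normrM !gtr0_norm// mulrAC divff ?gt_eqF// mul1r ltxx.
have [e [Be ne]] := @filter_ex _ (0 : R)^'+ _ _ (filterI nearB near_ne).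
have [x _ [[i j] /= ij vij]] := Bt _ Be.
exact: (ne (x, (i, j)) ij vij).
Unshelve. all: by end_near. Qed.

End Payoffs.

Theorem theorem9p4 (R : realType) (n : nat) (X : finPointedType)
    (delta lambda : R)
    (hdelta : 0 < delta < 1) (hlambda : 0 < lambda < 1) :
  (forall (u : 'I_n.+1 -> X -> R) (Pi : strategy R n X) (M : realization Pi),
     is_MPE delta lambda u M ->
     (forall b : worldview R n, {ae Pr M b, forall w,
        cluster ((fun t => view M t w) @ \oo) `<=` Zset delta lambda u M}) /\
     (forall p x, Zset delta lambda u M p -> zstar u p x ->
        [/\ U u p x = h u p, h u p = Mx u x &
            forall i, 0 < weight p i -> u i x = Mx u x])) /\
  (forall (u : 'I_n.+1 -> X -> R) (Pi : strategy R n X) (M : realization Pi),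
     is_MPE delta lambda u M ->
     (forall x, XI u x -> unique_argmax u x) ->
     forall b : worldview R n, exists Jinf : Omega M -> 'I_n.+1,
       (forall j, measurable (Jinf @^-1` [set j])) /\
       {ae Pr M b, forall w, converges_to w (Jinf w)}) /\
  (bad_payoffs R n X delta lambda `<=`
     \bigcup_(x in [set: X]) \bigcup_(ij in [set ij : 'I_n.+1 * 'I_n.+1 | (ij.1 < ij.2)%N])
       [set u | u ij.1 x = u ij.2 x] /\
   interior (bad_payoffs R n X delta lambda
     : set {ptws 'I_n.+1 -> {ptws X -> R}}) = set0) /\
  (forall (u : 'I_n.+1 -> X -> R) (Pi : strategy R n X) (M : realization Pi)
      (xs : 'I_n.+1 -> X),
     is_MPE delta lambda u M ->
     (forall x, XI u x -> unique_argmax u x) ->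
     (forall j, zstar u (vertex R j) = [set xs j]) ->
     lambda_hat u xs < lambda ->
     forall b : worldview R n, {ae Pr M b, forall w,
       exists t j, view M t w = vertex R j /\ absorbing Pi (vertex R j)}).
Proof.
split; [|split; [|split; [split|]]].
- move=> u Pi M E; split=> [b|p x]; last exact: Zset_payoff hdelta hlambda E p x.
  have [N [mN N0 sN]] := ae_view_optimal hdelta (fun a => (E a).1) E b.
  exists N; split => // w /= hw; apply: sN => /= aC; apply: hw.
  exact: (cluster_path_Zset hdelta hlambda E aC).
- move=> u Pi M E uniq b; have [Jinf [mJ JP]] := limit_index_measurable M.
  exists Jinf; split => //.
  have [N [mN N0 sN]] := ae_converges_to hdelta hlambda b E uniq.
  by exists N; split => // w /= hw; apply: sN => /= -[j /JP]; exact: hw.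
- exact: bad_payoffs_tie.
- exact/interior_ties/bad_payoffs_tie.
- move=> u Pi M xs E uniq hxs hl b.
  have [N [mN N0 sN]] := ae_view_optimal hdelta (fun a => (E a).1) E b.
  exists N; split => // w /= hw; apply: sN => /= aC; apply: hw.
  exact: (path_absorbed hdelta hlambda E uniq hxs hl aC).
Qed.
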